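(* Let $\overrightarrow{C}=(C_1,\dots,C_l)$, $\overrightarrow{D}=(D_1,\dots,D_m)$, $\overrightarrow{C}'=(C'_1,\dots,C'_{l'})$, $\overrightarrow{D}'=(D'_1,\dots,D'_{m'})$ be projector systems in $M_n(\mathbb{C})$ of types $\overrightarrow{\mu},\overrightarrow{\nu},\overrightarrow{\mu}',\overrightarrow{\nu}'$ respectively. Let $r:\overrightarrow{\mu}\to\overrightarrow{\mu}'$ and $s:\overrightarrow{\nu}\to\overrightarrow{\nu}'$ be refinements (so $r:\{1,\dots,l'\}\to\{1,\dots,l\}$ and $s:\{1,\dots,m'\}\to\{1,\dots,m\}$ as functions) such that $\overrightarrow{C}=\operatorname{Proj}(r)(\overrightarrow{C}')$ and $\overrightarrow{D}=\operatorname{Proj}(s)(\overrightarrow{D}')$. Then: (1) The numbers $\beta_{\overrightarrow{C}\overrightarrow{D}}(i,j)=\operatorname{Tr}(C_iD_j)$ are non-negative reals, and $$\operatorname{Tr}(C_iD_j)=\sum_{r(i')=i,\ s(j')=j}\operatorname{Tr}(C'_{i'}D'_{j'})\qquad(1\le i\le l,\ 1\le j\le m),$$ that is, $\beta_{\overrightarrow{C}\overrightarrow{D}}=\mathfrak{V}(r\times s)(\beta_{\overrightarrow{C}'\overrightarrow{D}'})$ as valuations on $\{1,\dots,l\}\times\{1,\dots,m\}$. (2) Consequently $\mathsf{Born}_{CD}\sqsubseteq\mathsf{Born}_{C'D'}$ in the specialization order of $\mathfrak{V}_{B^2}(\Sigma^2)$. (3) If $C_i$ is written as $\sum_k|\psi_k\rangle\langle\psi_k|$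 for orthonormal vectors $|\psi_k\rangle\in\mathbb{C}^n$, then $\beta_{\overrightarrow{C}\overrightarrow{D}}(i,j)=\sum_k\langle\psi_k|D_j|\psi_k\rangle$; in particular, if $C_i$ has trace $1$, so that $C_i=|\psi\rangle\langle\psi|$ for a unit vector $|\psi\rangle$, then $\beta_{\overrightarrow{C}\overrightarrow{D}}(i,j)=\langle\psi|D_j|\psi\rangle$, which is the probability given by the Born rule for the state $|\psi\rangle$.
   Context: Fix $n\ge 1$. A projector is a self-adjoint idempotent in $M_n(\mathbb{C})$. **Projector systems.** A projector system is a finite sequence $\overrightarrow{C}=(C_1,\dots,C_l)$ of nonzero projectors in $M_n(\mathbb{C})$ that is orthogonal ($C_iC_j=0$ for $i\ne j$) and complete ($\sum_iC_i=1$). Its type is the sequence $(\operatorname{Tr}C_1,\dots,\operatorname{Tr}C_l)$ of traces, an ordered partition of $n$ into positive integers. For a partition $\overrightarrow{\mu}$ of length $l$, $\operatorname{Proj}(\overrightarrow{\mu})$ is the space (locale) of projector systems of type $\overrightarrow{\mu}$, a subspace of $\mathbb{C}^{ln^2}$ defined by equations. Over it there is the trivial bundle $\operatorname{Proj}(\overrightarrow{\mu})\times\{1,\dots,l\}\to\operatorname{Proj}(\overrightarrow{\mu})$. **Refinements.** For partitions $(\nu_j)_{j=1}^m$ and $(\mu_i)_{i=1}^l$ of $n$, a refinement from $\overrightarrow{\nu}$ to $\overrightarrow{\mu}$ is a function $r:\{1,\dots,l\}\to\{1,\dots,m\}$ with $\nu_j=\sum_{r(i)=j}\mu_i$ for every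 $j$. It induces $\operatorname{Proj}(r):\operatorname{Proj}(\overrightarrow{\mu})\to\operatorname{Proj}(\overrightarrow{\nu})$, $\operatorname{Proj}(r)(\overrightarrow{C})_j=\sum_{r(i)=j}C_i$, and the bundle map $(\overrightarrow{C},i)\mapsto(\operatorname{Proj}(r)(\overrightarrow{C}),r(i))$. **Specialization.** For points (or generalized points, i.e. maps) $x,y$ of a locale, $x\sqsubseteq y$ means that every open containing $x$ contains $y$ (for maps $f,g:X\to Y$: $f^*V\le g^*V$ for all opens $V$ of $Y$). **The bundle $p:\Sigma\to B$.** It is the lax colimit, in locales, of the diagram of bundles whose shape is the opposite of the category of partitions of $n$ and refinements, which assigns to each partition $\overrightarrow{\mu}$ (of length $l$) the trivial bundle $\operatorname{Proj}(\overrightarrow{\mu})\times\{1,\dots,l\}\to\operatorname{Proj}(\overrightarrow{\mu})$ and to each refinement $r:\overrightarrow{\nu}\to\overrightarrow{\mu}$ the bundle map given by $\overrightarrow{C}\mapsto\operatorname{Proj}(r)(\overrightarrow{C})$ on base spaces and $(\overrightarrow{C},i)\mapsto(\operatorname{Proj}(r)(\overrightarrow{C}),r(i))$ on bundle spaces. Thus $B$ is universal with maps from all the $\operatorname{Proj}(\overrightarrow{\mu})$ (the image of $\overrightarrow{C}$ being written $C$) subject to: the image of $\operatorname{Proj}(r)(\overrightarrow{C})$ is $\sqsubseteq$ the image of $\overrightarrow{C}$ for each refinement $r$. Likewise $\Sigma$ is universal with maps from all the $\operatorname{Proj}(\overrightarrow{\mu})\times\{1,\dots,l\}$ subject to: the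 image of $(\operatorname{Proj}(r)(\overrightarrow{C}),r(i))$ is $\sqsubseteq$ the image of $(\overrightarrow{C},i)$. Write $\Sigma^2\to B^2$ for the product bundle $p\times p$. **Valuations.** A valuation on a locale $X$ is a Scott continuous map $m$ from the frame of opens of $X$ to the lower reals $[0,\infty]$ with $m(\emptyset)=0$ and $m(U\vee V)+m(U\wedge V)=m(U)+m(V)$. $\mathfrak{V}X$ is the locale whose points are the valuations on $X$; it is functorial in $X$ by push-forward, $\mathfrak{V}(f)(m)(V)=m(f^*V)$. A valuation on a finite discrete set with decidable equality is determined by its values on the elements. For a bundle $Y\to A$ of locales, $\mathfrak{V}_AY\to A$ is the bundle obtained by applying $\mathfrak{V}$ to the corresponding internal locale in the topos of sheaves over $A$. The construction is geometric (preserved by pullback along maps $A'\to A$), so the fibre of $\mathfrak{V}_AY$ over $a$ is $\mathfrak{V}$ of the fibre of $Y$ over $a$. **Born valuations.** For projector systems $\overrightarrow{C},\overrightarrow{D}$ of types $\overrightarrow{\mu},\overrightarrow{\nu}$ of lengths $l,m$, let $\beta_{\overrightarrow{C}\overrightarrow{D}}$ be the valuation on the finite discrete set $\{1,\dots,l\}\times\{1,\dots,m\}$ given on elements by $\beta_{\overrightarrow{C}\overrightarrow{D}}(i,j)=\operatorname{Tr}(C_iD_j)$. The bundle map from $\operatorname{Proj}(\overrightarrow{\mu})\times\operatorname{Proj}(\overrightarrow{\nu})\times\{1,\dots,l\}\times\{1,\dots,m\}$ (over $\operatorname{Proj}(\overrightarrow{\mu})\times\operatorname{Proj}(\overrightarrow{\nu})$)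 to $\Sigma^2$ (over $B^2$) induces a map $\operatorname{Proj}(\overrightarrow{\mu})\times\operatorname{Proj}(\overrightarrow{\nu})\times\mathfrak{V}(\{1,\dots,l\}\times\{1,\dots,m\})\to\mathfrak{V}_{B^2}(\Sigma^2)$. $\mathsf{Born}_{CD}$ is the image of $(\overrightarrow{C},\overrightarrow{D},\beta_{\overrightarrow{C}\overrightarrow{D}})$ under this map, a point of $\mathfrak{V}_{B^2}(\Sigma^2)$ lying over $(C,D)$. *)

(* Defs.v *)
From HB Require Import structures.
From Stdlib Require List.
From mathcomp Require Import all_boot all_order all_algebra.
From mathcomp Require Import complex.
From mathcomp Require Import all_classical all_reals all_analysis.

Set Implicit Arguments.
Unset Strict Implicit.
Unset Printing Implicit Defensive.

Import Order.TTheory GRing.Theory Num.Theory.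
Import numFieldNormedType.Exports.

Local Open Scope classical_set_scope.

#[local] Obligation Tactic := idtac.

(* A locale is given by its frame of opens.  The order is Prop-valued, like
   inclusion in classical_sets; antisymmetry is Leibniz. *)
Record locale := Locale {
  opens :> Type;
  ole : opens -> opens -> Prop;
  otop : opens;
  omeet : opens -> opens -> opens;
  osup : set opens -> opens;
  ole_refl : forall U, ole U U;
  ole_trans : forall V U W, ole U V -> ole V W -> ole U W;
  ole_anti : forall U V, ole U V -> ole V U -> U = V;
  ole_top : forall U, ole U otop;
  ole_meet : forall W U V, ole W (omeet U V) <-> ole W U /\ ole W V;
  osup_le : forall S V, ole (osup S) V <-> (forall U, S U -> ole U V);
  odistr : forall U S,
    ole (omeet U (osup S)) (osup [set omeet U V | V in S]) }.

Arguments otop {l}.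
Arguments ole_refl {l}.

Definition obot {X : locale} : X := osup set0.
Definition ojoin {X : locale} (U V : X) : X := osup [set W | W = U \/ W = V].

Section OrderFacts.
Context {X : locale}.
Implicit Types U V W : X.

Lemma osup_ub (S : set X) U : S U -> ole U (osup S).
Proof. by move=> SU; apply: (proj1 (osup_le S (osup S)) (ole_refl _)). Qed.

Lemma omeetl U V : ole (omeet U V) U.
Proof. by case: (proj1 (ole_meet (omeet U V) U V) (ole_refl _)). Qed.

Lemma omeetr U V : ole (omeet U V) V.
Proof. by case: (proj1 (ole_meet (omeet U V) U V) (ole_refl _)). Qed.

Lemma omeet_glb W U V : ole W U -> ole W V -> ole W (omeet U V).
Proof. by move=> h1 h2; apply/ole_meet. Qed.

Lemma omeet_mono U U' V V' :
  ole U U' -> ole V V' -> ole (omeet U V) (omeet U' V').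
Proof.
move=> h k; apply: omeet_glb.
  exact: ole_trans (omeetl U V) h.
exact: ole_trans (omeetr U V) k.
Qed.

Lemma osup_mono (S T : set X) :
  (forall U, S U -> exists2 V, T V & ole U V) -> ole (osup S) (osup T).
Proof.
move=> h; apply/osup_le => U /h[V TV UV].
exact: ole_trans UV (osup_ub TV).
Qed.

Lemma obot_le U : ole obot U.
Proof. by apply/osup_le. Qed.

Lemma ojoinl U V : ole U (ojoin U V).
Proof. by apply: osup_ub; left. Qed.

Lemma ojoinr U V : ole V (ojoin U V).
Proof. by apply: osup_ub; right. Qed.

Lemma ojoin_lub U V W : ole U W -> ole V W -> ole (ojoin U V) W.
Proof. by move=> h k; apply/osup_le => _ [->|->]. Qed.

Lemma omeet_sup_le U (S : set X) W :
  (forall V, S V -> ole (omeet U V) W) -> ole (omeet U (osup S)) W.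
Proof.
move=> h; apply: ole_trans (odistr U S) _.
by apply/osup_le => _ [V SV <-]; apply: h.
Qed.

End OrderFacts.

(* A map of locales, given by its inverse image. *)
Record lmap (X Y : locale) := Lmap {
  inv :> Y -> X;
  inv_top : inv otop = otop;
  inv_meet : forall U V, inv (omeet U V) = omeet (inv U) (inv V);
  inv_sup : forall S, inv (osup S) = osup [set inv U | U in S] }.

Lemma lmap_ext (X Y : locale) (f g : lmap X Y) :
  (forall V, inv f V = inv g V) -> f = g.
Proof.
case: f => f f1 f2 f3; case: g => g g1 g2 g3 /= h.
have E : f = g by apply: funext.
by subst g; congr Lmap; apply: Prop_irrelevance.
Qed.

Section LmapFacts.
Context {X Y : locale} (f : lmap X Y).

Lemma inv_mono U V : ole U V -> ole (f U) (f V).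
Proof.
move=> UV.
have -> : U = omeet U V.
  apply: ole_anti; last exact: omeetl.
  by apply: omeet_glb => //; apply: ole_refl.
by rewrite inv_meet; apply: omeetr.
Qed.

Lemma inv_bot : f obot = obot.
Proof. by rewrite inv_sup image_set0. Qed.

Lemma inv_join U V : f (ojoin U V) = ojoin (f U) (f V).
Proof.
rewrite inv_sup; congr osup; apply/seteqP; split.
  by move=> _ [W [->|->] <-]; [left|right].
by move=> _ [->|->]; [exists U => //; left|exists V => //; right].
Qed.

End LmapFacts.

Definition spec {X Y : locale} (f g : lmap X Y) : Prop :=
  forall V : Y, ole (f V) (g V).

Program Definition lid (X : locale) : lmap X X := @Lmap X X idfun _ _ _.
Next Obligation. by []. Qed.
Next Obligation. by []. Qed.
Next Obligation. by move=> X S; rewrite image_id. Qed.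

Program Definition lcomp (X Y Z : locale) (g : lmap Y Z) (f : lmap X Y) :
  lmap X Z := @Lmap X Z (f \o g) _ _ _.
Next Obligation. by move=> *; rewrite /= !inv_top. Qed.
Next Obligation. by move=> *; rewrite /= !inv_meet. Qed.
Next Obligation. by move=> *; rewrite /= !inv_sup image_comp. Qed.

Lemma spec_lcomp (X Y Z : locale) (g g' : lmap Y Z) (f : lmap X Y) :
  spec g g' -> spec (lcomp g f) (lcomp g' f).
Proof. by move=> h V; apply: (inv_mono f); apply: h. Qed.

Program Definition discLoc (I : Type) : locale :=
  @Locale (set I) (@subset I) setT (@setI I) (fun S => \bigcup_(U in S) U)
          _ _ _ _ _ _ _.
Next Obligation. by move=> I U x. Qed.
Next Obligation. by move=> I V U W; exact: subset_trans. Qed.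
Next Obligation. by move=> I U V *; apply/seteqP. Qed.
Next Obligation. by move=> I U x. Qed.
Next Obligation. by move=> I W U V; rewrite subsetI. Qed.
Next Obligation.
move=> I S V; split=> [h U SU x Ux|h x [U SU Ux]]; [by apply: h; exists U|exact: h Ux].
Qed.
Next Obligation.
by move=> I U S x [Ux [V SV Vx]]; exists (U `&` V) => //; exists V.
Qed.

Program Definition discMap (I J : Type) (f : I -> J) :
  lmap (discLoc I) (discLoc J) := @Lmap (discLoc I) (discLoc J)
    (fun V => f @^-1` V) _ _ _.
Next Obligation. by []. Qed.
Next Obligation. by []. Qed.
Next Obligation.
move=> I J f S; apply/seteqP; split=> x /=.
  by move=> [V SV Vx]; exists (f @^-1` V) => //; exists V.
by move=> [_ [V SV <-] Vx]; exists V.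
Qed.

(* The terminal locale: a point of X is a map ptLoc -> X. *)
Definition ptLoc : locale := discLoc unit.

Program Definition toPt (X : locale) : lmap X ptLoc :=
  @Lmap X ptLoc (fun P => osup [set U | P tt]) _ _ _.
Next Obligation.
by move=> X; apply: ole_anti; [apply: ole_top|apply: osup_ub].
Qed.
Next Obligation.
move=> X P Q; apply: ole_anti.
  by apply/osup_le => W [Ut Vt]; apply: omeet_glb; apply: osup_ub.
apply: omeet_sup_le => W Vt; apply: ole_trans (omeetl _ _) _.
by apply/osup_le => W' Ut; apply: osup_ub.
Qed.
Next Obligation.
move=> X S; apply: ole_anti; apply/osup_le.
  move=> W [V SV Vt]; apply: (ole_trans (V := osup [set U : X | V tt])).
    exact: osup_ub.
  by apply: osup_ub; exists V.
move=> _ [V SV <-]; apply/osup_le => W Vt; apply: osup_ub.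
by exists V.
Qed.

(* The locale classifying a propositional geometric theory, i.e. the frame
   presented by generators G and relations
     g_1 /\ ... /\ g_k  <=  \/_(F in SS) /\F      (Ax [:: g_1; ...; g_k] SS):
   an open is a set of finite meets of generators (lists, read as
   conjunctions), closed under strengthening and under the relations. *)
Section Presentation.
Variables (G : Type) (Ax : seq G -> set (seq G) -> Prop).

Record presopen (J : set (seq G)) : Prop := Presopen {
  cl_weak : forall F F', List.incl F F' -> J F -> J F';
  cl_ax : forall F SS E, Ax F SS ->
    (forall F', SS F' -> J (F' ++ E)) -> J (F ++ E) }.

Definition closure_of (J : set (seq G)) : set (seq G) :=
  [set F | forall K, presopen K -> J `<=` K -> K F].

Lemma sub_closure J : J `<=` closure_of J.
Proof. by move=> F JF K _; apply. Qed.

Lemma closure_min J K : presopen K -> J `<=` K -> closure_of J `<=` K.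
Proof. by move=> cK JK F; apply. Qed.

Lemma closure_presopen J : presopen (closure_of J).
Proof.
split=> [F F' FF' JF K cK JK|F SS E a h K cK JK].
  by apply: (cl_weak cK) FF' _; apply: JF.
by apply: (cl_ax cK a) => F' SF'; apply: h.
Qed.

Lemma presopenT : presopen setT. Proof. by []. Qed.

Lemma presopenI J K : presopen J -> presopen K -> presopen (J `&` K).
Proof.
move=> cJ cK; split=> [F F' FF' [JF KF]|F SS E a h].
  by split; [apply: cl_weak FF' JF|apply: cl_weak FF' KF].
by split; [apply: (cl_ax cJ a)|apply: (cl_ax cK a)] => F' /h[].
Qed.

Lemma presopen_imp (J K : set (seq G)) : presopen K ->
  presopen [set F | forall E, J E -> K (F ++ E)].
Proof.
move=> cK; split=> [F F' FF' h E JE|F SS E a h E' JE'].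
  by apply: cl_weak (h E JE) => //; apply: List.incl_app_app.
by rewrite -catA; apply: (cl_ax cK a) => F' SF'; rewrite catA; apply: h.
Qed.

Lemma incl_dup (F : seq G) : List.incl (F ++ F) F.
Proof. by move=> g /List.in_app_iff[]. Qed.

Program Definition presLoc : locale :=
  @Locale {J | presopen J} (fun J K => sval J `<=` sval K)
    (exist _ setT presopenT)
    (fun J K => exist _ _ (presopenI (proj2_sig J) (proj2_sig K)))
    (fun S => exist _ _ (closure_presopen (\bigcup_(J in S) sval J)))
    _ _ _ _ _ _ _.
Next Obligation. by move=> J F. Qed.
Next Obligation. by move=> [J ?] [K ?] [L ?] /= h k; exact: subset_trans h k. Qed.
Next Obligation.
move=> [J cJ] [K cK] /= h k; have E : J = K by apply/seteqP.
by subst K; congr exist; apply: Prop_irrelevance.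
Qed.
Next Obligation. by move=> J F. Qed.
Next Obligation. by move=> W U V; rewrite /= subsetI. Qed.
Next Obligation.
move=> S [K cK] /=; split=> [h J SJ F JF|h].
  by apply: h; apply: sub_closure; exists J.
by apply: closure_min => // F [J SJ JF]; apply: h JF.
Qed.
Next Obligation.
move=> [J cJ] S /= F [JF SF].
set T := (X in closure_of X).
suff h : closure_of (\bigcup_(K in S) sval K) `<=`
    [set F | forall E, J E -> closure_of T (F ++ E)].
  by apply: (cl_weak (closure_presopen T)) (h F SF F JF); apply: incl_dup.
apply: closure_min; first exact/presopen_imp/closure_presopen.
move=> F' [[K cK] SK KF'] E JE; apply: sub_closure.
exists (exist _ _ (presopenI cJ cK)); first by exists (exist _ K cK).
split; first by apply: cl_weak JE => //; apply/List.incl_appr/List.incl_refl.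
by apply: cl_weak KF' => //; apply/List.incl_appl/List.incl_refl.
Qed.

Definition pgen (g : G) : presLoc :=
  exist _ _ (closure_presopen [set [:: g]]).

Section Universal.
Variables (X : locale) (h : G -> X).

Definition gmeet (F : seq G) : X := foldr (fun g U => omeet (h g) U) otop F.
Definition gjoin (SS : set (seq G)) : X := osup [set gmeet F | F in SS].

Lemma conj_le F U : ole U (gmeet F) <-> forall g, List.In g F -> ole U (h g).
Proof.
elim: F => [|g F IH] /=; first by split=> // _; apply: ole_top.
rewrite ole_meet IH; split=> [[Ug UF] g' [<-//|]|H]; first exact: UF.
by split=> [|g' g'F]; apply: H; [left|right].
Qed.

Lemma conj_incl F F' : List.incl F F' -> ole (gmeet F') (gmeet F).
Proof.
move=> FF'; apply/conj_le => g /FF' gF'.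
by apply: (proj1 (conj_le F' _)) (ole_refl _) _ gF'.
Qed.

Lemma conj_cat F F' : gmeet (F ++ F') = omeet (gmeet F) (gmeet F').
Proof.
apply: ole_anti.
  by apply: omeet_glb; apply: conj_incl => g gF; apply/List.in_app_iff; auto.
apply/conj_le => g /List.in_app_iff[gF|gF].
  by apply: ole_trans (omeetl _ _) _; apply: (proj1 (conj_le F _)) (ole_refl _) _ gF.
by apply: ole_trans (omeetr _ _) _; apply: (proj1 (conj_le F' _)) (ole_refl _) _ gF.
Qed.

Hypothesis hAx : forall F SS, Ax F SS -> ole (gmeet F) (gjoin SS).

Lemma presopen_below (U : X) : presopen [set F | ole (gmeet F) U].
Proof.
split=> [F F' FF' /= FU|F SS E a /= H].
  exact: ole_trans (conj_incl FF') FU.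
have s F' V : ole (gmeet (F' ++ E)) V <-> ole (omeet (gmeet E) (gmeet F')) V.
  rewrite conj_cat; split; apply: ole_trans; apply: omeet_glb;
    by [apply: omeetl|apply: omeetr].
apply/s; apply: ole_trans (omeet_mono (ole_refl _) (hAx a)) _.
by apply: omeet_sup_le => _ [F' SF' <-]; apply/s/H.
Qed.

Lemma disj_closure T U : (forall F, T F -> ole (gmeet F) U) ->
  ole (gjoin (closure_of T)) U.
Proof.
move=> H; apply/osup_le => _ [F cF <-].
exact: (closure_min (presopen_below U) H).
Qed.

(* A model of the theory in the frame of X is a map X -> presLoc. *)
Program Definition presMap : lmap X presLoc :=
  @Lmap X presLoc (fun J => gjoin (sval J)) _ _ _.
Next Obligation.
apply: ole_anti; first exact: ole_top.
by apply: osup_ub; exists [::].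
Qed.
Next Obligation.
move=> [J cJ] [K cK] /=; apply: ole_anti.
  apply/osup_le => _ [F [JF KF] <-].
  by apply: omeet_glb; apply: osup_ub; exists F.
apply: omeet_sup_le => _ [F KF <-].
apply: (ole_trans (V := omeet (gmeet F) (gjoin J))).
  by apply: omeet_glb; [apply: omeetr|apply: omeetl].
apply: omeet_sup_le => _ [E JE <-]; rewrite -conj_cat; apply: osup_ub.
exists (F ++ E) => //; split.
  by apply: cl_weak JE => //; apply/List.incl_appr/List.incl_refl.
by apply: cl_weak KF => //; apply/List.incl_appl/List.incl_refl.
Qed.
Next Obligation.
move=> S /=; apply: ole_anti.
  apply: disj_closure => F [J SJ JF].
  apply: (ole_trans (V := gjoin (sval J))); first by apply: osup_ub; exists F.
  by apply: osup_ub; exists J.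
apply/osup_le => _ [J SJ <-]; apply/osup_le => _ [F JF <-].
by apply: osup_ub; exists F => //; apply: sub_closure; exists J.
Qed.

Lemma presMap_gen g : presMap (pgen g) = h g.
Proof.
apply: ole_anti => /=.
  by apply: disj_closure => _ ->; apply: omeetl.
apply: (ole_trans (V := gmeet [:: g])).
  by apply: omeet_glb; [apply: ole_refl|apply: ole_top].
by apply: osup_ub; exists [:: g] => //; apply: sub_closure.
Qed.

End Universal.

Lemma mem_conj_pgen F : sval (gmeet pgen F) F.
Proof.
suff h F' : List.incl F' F -> sval (gmeet pgen F') F by apply: h => g.
elim: F' => [|g F' IH] //= gF'F; split.
  apply: (cl_weak (closure_presopen _) _ (sub_closure (erefl _))).
  by move=> _ [<-|//]; apply: gF'F; left.
by apply: IH => g' g'F'; apply: gF'F; right.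
Qed.

Lemma conj_pgen_le F (J : presLoc) : ole (gmeet pgen F) J <-> sval J F.
Proof.
split=> [|JF]; first by apply; apply: mem_conj_pgen.
case: J JF => J cJ /= JF E FE.
suff h K H : presopen K -> K (F ++ H) -> K (E ++ H).
  by rewrite -[E]cats0; apply: h => //; rewrite cats0.
elim: F {JF} E FE H => [|g F IH] E /= FE H cK KH.
  by apply: cl_weak KH => //; apply/List.incl_appr/List.incl_refl.
case: FE => gE FE.
suff h : closure_of [set [:: g]] `<=`
    [set E' | forall E'', sval (gmeet pgen F) E'' -> K (E' ++ E'' ++ H)].
  apply: (cl_weak cK) (h E gE E FE) => g'.
  by rewrite !List.in_app_iff; tauto.
apply: closure_min.
  split=> [F1 F2 F12 H1 E'' /H1|F1 SS E1 a H1 E'' E''F].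
    by apply: (cl_weak cK); apply: List.incl_app_app.
  by rewrite -catA; apply: (cl_ax cK a) => F' /H1; rewrite catA; apply.
move=> _ -> E'' E''F /=.
have : K (E'' ++ g :: H).
  apply: IH => //; apply: (cl_weak cK) KH => g' /=.
  by rewrite !List.in_app_iff /=; tauto.
by apply: (cl_weak cK) => g' /=; rewrite !List.in_app_iff /=; tauto.
Qed.

Lemma disj_pgen (J : presLoc) : J = gjoin pgen (sval J).
Proof.
apply: ole_anti; last by apply/osup_le => _ [F JF <-]; apply/conj_pgen_le.
case: J => J cJ F JF /=; apply: sub_closure; exists (gmeet pgen F).
  by exists F.
exact: mem_conj_pgen.
Qed.

Lemma pgen_ax F SS : Ax F SS -> ole (gmeet pgen F) (gjoin pgen SS).
Proof.
move=> a; apply/conj_pgen_le; rewrite -[F]cats0.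
apply: (cl_ax (proj2_sig _) a) => F' SF'; rewrite cats0.
by apply: sub_closure; exists (gmeet pgen F'); [exists F'|apply: mem_conj_pgen].
Qed.

End Presentation.

Lemma inv_gmeet (X Y : locale) (f : lmap X Y) G (h : G -> Y) F :
  f (gmeet h F) = gmeet (f \o h) F.
Proof. by elim: F => [|g F IH] /=; rewrite ?inv_top // inv_meet IH. Qed.

Lemma inv_gjoin (X Y : locale) (f : lmap X Y) G (h : G -> Y) SS :
  f (gjoin h SS) = gjoin (f \o h) SS.
Proof.
rewrite inv_sup /gjoin image_comp; congr osup.
by apply: eq_imagel => F _ /=; apply: inv_gmeet.
Qed.

Lemma presLoc_ext (X : locale) G (Ax : seq G -> set (seq G) -> Prop)
    (f f' : lmap X (presLoc Ax)) :
  (forall g, f (pgen Ax g) = f' (pgen Ax g)) -> f = f'.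
Proof.
move=> h; apply: lmap_ext => J; rewrite [J]disj_pgen !inv_gjoin.
by have -> : f \o pgen Ax = f' \o pgen Ax by apply: funext.
Qed.

Lemma pgen_le (G : Type) (Ax : seq G -> set (seq G) -> Prop) F SS SS' :
  Ax F SS ->
  (forall E, SS E -> exists2 E', SS' E' &
    ole (gmeet (pgen Ax) E) (gmeet (pgen Ax) E')) ->
  ole (gmeet (pgen Ax) F) (gjoin (pgen Ax) SS').
Proof.
move=> a h; apply: ole_trans (pgen_ax a) _; apply: osup_mono.
by move=> _ [E /h[E' SE' EE'] <-]; exists (gmeet (pgen Ax) E') => //; exists E'.
Qed.

Lemma conj1 (X : locale) G (h : G -> X) g : gmeet h [:: g] = h g.
Proof.
apply: ole_anti; first exact: omeetl.
by apply: omeet_glb; [apply: ole_refl|apply: ole_top].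
Qed.

Lemma disj1 (X : locale) G (h : G -> X) F : gjoin h [set F] = gmeet h F.
Proof.
apply: ole_anti; last by apply: osup_ub; exists F.
by apply/osup_le => _ [_ -> <-]; apply: ole_refl.
Qed.

(* The relations stating that e preserves finite meets and arbitrary joins. *)
Inductive homAx (X : locale) (G : Type) (e : X -> G) :
    seq G -> set (seq G) -> Prop :=
| HomTop : homAx e [::] [set [:: e otop]]
| HomMeet U V : homAx e [:: e U; e V] [set [:: e (omeet U V)]]
| HomSup U S : ole U (osup S) -> homAx e [:: e U] [set [:: e V] | V in S].

Lemma homAx_sound (X Y : locale) (G : Type) (e : X -> G) (h : G -> Y)
    (f : lmap Y X) :
  (forall U, h (e U) = f U) ->
  forall F SS, homAx e F SS -> ole (gmeet h F) (gjoin h SS).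
Proof.
move=> he F SS [|U V|U S US]; rewrite ?disj1 ?conj1 /= ?he.
- by rewrite inv_top; apply: ole_refl.
- rewrite inv_meet; apply: omeet_mono; first exact: ole_refl.
  exact: omeetl.
- apply: ole_trans (inv_mono f US) _; rewrite inv_sup.
  apply: osup_mono => _ [V SV <-]; exists (f V); last exact: ole_refl.
  by exists [:: e V]; [exists V|rewrite conj1 he].
Qed.

Section HomGen.
Variables (X : locale) (G : Type) (Ax : seq G -> set (seq G) -> Prop).
Variables (e : X -> G) (hAx : forall F SS, homAx e F SS -> Ax F SS).
Let g U : presLoc Ax := pgen Ax (e U).

Let g_sup U S : ole U (osup S) -> ole (g U) (osup [set g V | V in S]).
Proof.
move=> /(HomSup e)/hAx/pgen_ax; rewrite conj1 => h; apply: ole_trans h _.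
apply: osup_mono => _ [_ [V SV <-] <-]; rewrite conj1.
by exists (g V); [exists V|apply: ole_refl].
Qed.

Let g_mono U V : ole U V -> ole (g U) (g V).
Proof.
move=> UV; have : ole U (osup [set V]) by apply: ole_trans UV (osup_ub _).
by move/g_sup => h; apply: ole_trans h _; apply/osup_le => _ [_ -> <-]; apply: ole_refl.
Qed.

Program Definition genMap : lmap (presLoc Ax) X := @Lmap (presLoc Ax) X g _ _ _.
Next Obligation.
apply: ole_anti; first exact: ole_top.
by have := pgen_ax (hAx (HomTop e)); rewrite disj1 conj1.
Qed.
Next Obligation.
move=> U V; apply: ole_anti.
  by apply: omeet_glb; apply: g_mono; [apply: omeetl|apply: omeetr].
have := pgen_ax (hAx (HomMeet e U V)); rewrite disj1 conj1 => h.
apply: ole_trans h; apply: omeet_mono; first exact: ole_refl.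
by apply: omeet_glb; [apply: ole_refl|apply: ole_top].
Qed.
Next Obligation.
move=> S; apply: ole_anti; first by apply: g_sup; apply: ole_refl.
by apply/osup_le => _ [V SV <-]; apply: g_mono; apply: osup_ub.
Qed.
End HomGen.

Section Product.
Variables X Y : locale.

Definition prodAx (F : seq (X + Y)) (SS : set (seq (X + Y))) : Prop :=
  homAx inl F SS \/ homAx inr F SS.

Definition prodLoc : locale := presLoc prodAx.

Definition lfst : lmap prodLoc X :=
  genMap (fun F SS (h : homAx inl F SS) => or_introl h : prodAx F SS).
Definition lsnd : lmap prodLoc Y :=
  genMap (fun F SS (h : homAx inr F SS) => or_intror h : prodAx F SS).

Section Pairing.
Variables (Z : locale) (f : lmap Z X) (g : lmap Z Y).
Let h (s : X + Y) : Z := match s with inl U => f U | inr V => g V end.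

Lemma lpair_sound F SS : prodAx F SS -> ole (gmeet h F) (gjoin h SS).
Proof. by case; [apply: (homAx_sound (f := f))|apply: (homAx_sound (f := g))]. Qed.

Definition lpair : lmap Z prodLoc := presMap lpair_sound.

Lemma lpair_fst U : lpair (lfst U) = f U.
Proof. exact: (presMap_gen lpair_sound (inl U)). Qed.

Lemma lpair_snd V : lpair (lsnd V) = g V.
Proof. exact: (presMap_gen lpair_sound (inr V)). Qed.
End Pairing.

Lemma lpair_ext (Z : locale) (f g : lmap Z prodLoc) :
  (forall U, f (lfst U) = g (lfst U)) -> (forall V, f (lsnd V) = g (lsnd V)) ->
  f = g.
Proof. by move=> h k; apply: presLoc_ext => -[U|V]; [apply: h|apply: k]. Qed.

End Product.

Arguments lfst {X Y}.
Arguments lsnd {X Y}.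

Definition lprodMap (X X' Y Y' : locale) (f : lmap X X') (g : lmap Y Y') :
  lmap (prodLoc X Y) (prodLoc X' Y') := lpair (lcomp f lfst) (lcomp g lsnd).

(* Lax colimit of a diagram of locales: universal with maps laxIn i subject to
   laxIn j \o act u being below laxIn i for every arrow u : i -> j.  As colimits
   of locales are limits of frames, its opens are compatible families. *)
Section LaxColimit.
Variables (I : Type) (X : I -> locale) (hom : I -> I -> Type).
Variable act : forall i j, hom i j -> lmap (X i) (X j).

Definition laxOpen (U : forall i, X i) : Prop :=
  forall i j (u : hom i j), ole (act u (U j)) (U i).

Lemma laxOpenT : laxOpen (fun=> otop).
Proof. by move=> i j u; apply: ole_top. Qed.

Lemma laxOpenI U V : laxOpen U -> laxOpen V -> laxOpen (fun i => omeet (U i) (V i)).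
Proof. by move=> oU oV i j u; rewrite inv_meet; apply: omeet_mono. Qed.

Lemma laxOpen_sup (S : set {U | laxOpen U}) :
  laxOpen (fun i => osup [set sval U i | U in S]).
Proof.
move=> i j u; rewrite inv_sup; apply: osup_mono => _ [_ [U SU <-] <-].
by exists (sval U i); [exists U|apply: (proj2_sig U)].
Qed.

Program Definition laxColim : locale :=
  @Locale {U | laxOpen U} (fun U V => forall i, ole (sval U i) (sval V i))
    (exist _ _ laxOpenT)
    (fun U V => exist _ _ (laxOpenI (proj2_sig U) (proj2_sig V)))
    (fun S => exist _ _ (laxOpen_sup S)) _ _ _ _ _ _ _.
Next Obligation. by move=> U i; apply: ole_refl. Qed.
Next Obligation. by move=> V U W UV VW i; apply: ole_trans (UV i) (VW i). Qed.
Next Obligation.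
move=> [U oU] [V oV] /= UV VU.
have E : U = V by apply: functional_extensionality_dep => i; apply: ole_anti.
by subst V; congr exist; apply: Prop_irrelevance.
Qed.
Next Obligation. by move=> U i; apply: ole_top. Qed.
Next Obligation.
move=> W U V; split=> [h|[h k] i]; last exact/ole_meet.
by split=> i; have /ole_meet[] := h i.
Qed.
Next Obligation.
move=> S V; split=> [h U SU i|h i].
  by apply: ole_trans (h i); apply: osup_ub; exists U.
by apply/osup_le => _ [U SU <-]; apply: h.
Qed.
Next Obligation.
move=> U S i /=; apply: omeet_sup_le => _ [V SV <-]; apply: osup_ub.
by eexists; [exists V; [exact: SV|reflexivity]|].
Qed.

Program Definition laxIn (i : I) : lmap (X i) laxColim :=
  @Lmap (X i) laxColim (fun U => sval U i) _ _ _.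
Next Obligation. by []. Qed.
Next Obligation. by []. Qed.
Next Obligation. by []. Qed.

Lemma laxIn_spec i j (u : hom i j) : spec (lcomp (laxIn j) (act u)) (laxIn i).
Proof. by move=> U; apply: (proj2_sig U). Qed.

Section Universal.
Variables (Y : locale) (f : forall i, lmap (X i) Y).
Hypothesis f_lax : forall i j (u : hom i j), spec (lcomp (f j) (act u)) (f i).

Program Definition laxDesc : lmap laxColim Y :=
  @Lmap laxColim Y (fun V => exist _ (fun i => f i V) _) _ _ _.
Next Obligation. by move=> V i j u; apply: f_lax. Qed.
Next Obligation. by apply: ole_anti => i /=; rewrite inv_top; apply: ole_refl. Qed.
Next Obligation.
by move=> U V; apply: ole_anti => i /=; rewrite inv_meet; apply: ole_refl.
Qed.
Next Obligation.
move=> S; apply: ole_anti => i /=; rewrite inv_sup; apply: osup_mono.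
  move=> _ [V SV <-]; exists (f i V); last exact: ole_refl.
  by eexists; [exists V; [exact: SV|reflexivity]|].
move=> _ [_ [V SV <-] <-]; exists (f i V); last exact: ole_refl.
by exists V.
Qed.

Lemma laxDesc_in i V : laxIn i (laxDesc V) = f i V.
Proof. by []. Qed.

Lemma laxDesc_uniq (g : lmap laxColim Y) :
  (forall i V, laxIn i (g V) = f i V) -> g = laxDesc.
Proof.
by move=> h; apply: lmap_ext => V; apply: ole_anti => i;
   rewrite /= -h; apply: ole_refl.
Qed.
End Universal.

End LaxColimit.

Record bundle := Bundle { btot : locale; bbase : locale; bproj :> lmap btot bbase }.
Arguments Bundle {btot bbase}.

Record bundleMap (p p' : bundle) := BundleMap {
  mtot : lmap (btot p) (btot p');
  mbase : lmap (bbase p) (bbase p');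
  mcomm : lcomp p' mtot = lcomp mbase p }.

(* A pair (a, U) of an open a of the base and an open U of the bundle space
   stands for the section U /\ p^*a over a of the internal frame of the bundle,
   and a set S of such pairs for the subsheaf of that frame it generates;
   idirected S says that this subsheaf is (internally) directed, and isup S is
   its internal join. *)
Definition isup (p : bundle) (S : set (bbase p * btot p)) : btot p :=
  osup [set omeet (p x.1) x.2 | x in S].

Definition idirected (p : bundle) (S : set (bbase p * btot p)) : Prop :=
  ole otop (osup [set a | exists U, S (a, U)]) /\
  forall a U b V, S (a, U) -> S (b, V) ->
    ole (omeet a b) (osup [set c | ole c (omeet a b) /\
      exists d W, [/\ S (d, W), ole c d,
        ole (omeet (p c) U) W & ole (omeet (p c) V) W]]).

(* The relative valuation locale over the base A of p : Y -> A, presented over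
   A by generators "m(U) > q" for U an open of Y and q rational: the relations
   are the axioms of a valuation of the internal frame with values in the lower
   reals [0,oo].  Over the one-point base idirected and isup are the usual
   directedness and join. *)
Section ValuationLocale.
Variable p : bundle.

Definition valGen : Type := bbase p + btot p * rat.
Definition gb (a : bbase p) : valGen := inl a.
Definition gt (U : btot p) (q : rat) : valGen := inr (U, q).

Local Open Scope ring_scope.

Inductive valAx : seq valGen -> set (seq valGen) -> Prop :=
| ValHom F SS : homAx gb F SS -> valAx F SS
| ValDown U q q' : q <= q' -> valAx [:: gt U q'] [set [:: gt U q]]
| ValOpen U q : valAx [:: gt U q] [set [:: gt U q'] | q' in [set q' | q < q']]
| ValNneg U q : q < 0 -> valAx [::] [set [:: gt U q]]
| ValBot q : 0 <= q -> valAx [:: gt obot q] set0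
| ValModl U V q r : valAx [:: gt U q; gt V r]
    [set [:: gt (ojoin U V) x.1; gt (omeet U V) x.2]
      | x in [set x | x.1 + x.2 = q + r]]
| ValModr U V q r : valAx [:: gt (ojoin U V) q; gt (omeet U V) r]
    [set [:: gt U x.1; gt V x.2] | x in [set x | x.1 + x.2 = q + r]]
| ValSup S q : idirected S ->
    valAx [:: gt (isup S) q] [set [:: gb x.1; gt x.2 q] | x in S]
| ValSub S q a U : idirected S -> S (a, U) ->
    valAx [:: gb a; gt U q] [set [:: gt (isup S) q]].

Definition valLoc : locale := presLoc valAx.

Definition valProj : lmap valLoc (bbase p) := genMap ValHom.

Definition vgt (U : btot p) (q : rat) : valLoc := pgen valAx (gt U q).

Lemma vgt_mono U V q : ole U V -> ole (vgt U q) (vgt V q).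
Proof.
move=> UV; pose S := [set x : bbase p * btot p | x = (otop, U) \/ x = (otop, V)].
have dS : idirected S.
  split.
    by apply: osup_ub; exists U; left.
  have h a W : S (a, W) -> a = otop /\ ole W V.
    by move=> [|] [-> ->]; split=> //; apply: ole_refl.
  move=> a W b W' /h[-> WV] /h[-> W'V]; apply: osup_ub; split.
    exact: ole_refl.
  exists otop, V; split; [by right|exact: ole_top| |].
    exact: ole_trans (omeetr _ _) WV.
  exact: ole_trans (omeetr _ _) W'V.
have E : isup S = V.
  apply: ole_anti.
    by apply/osup_le => _ [_ [->|->] <-] /=; [apply: ole_trans (omeetr _ _) UV|apply: omeetr].
  apply: (ole_trans (V := omeet (p otop) V)).
    by rewrite inv_top; apply: omeet_glb; [apply: ole_top|apply: ole_refl].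
  by apply: osup_ub; exists (otop, V) => //; right.
have := pgen_ax (ValSub q dS (or_introl (erefl _) : S (otop, U))).
rewrite disj1 conj1 E => h; apply: ole_trans h.
apply: omeet_glb; last by apply: omeet_glb; [apply: ole_refl|apply: ole_top].
by rewrite -[pgen valAx (gb otop)]/(valProj otop) inv_top; apply: ole_top.
Qed.

End ValuationLocale.

Arguments gb {p}.
Arguments gt {p}.

(* Push-forward along a bundle map: m is sent to V |-> m(f^*V). *)
Section ValMap.
Variables (p p' : bundle) (f : bundleMap p p').

Definition valMapGen (g : valGen p') : valGen p :=
  match g with inl a => gb (mbase f a) | inr (U, q) => gt (mtot f U) q end.

Let h (g : valGen p') : valLoc p := pgen (@valAx p) (valMapGen g).

Let hconj F : gmeet h F = gmeet (pgen (@valAx p)) (map valMapGen F).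
Proof. by elim: F => [|g F /= ->]. Qed.

Let himg F SS : valAx (map valMapGen F) [set map valMapGen E | E in SS] ->
  ole (gmeet h F) (gjoin h SS).
Proof.
rewrite hconj => a; apply: ole_trans (pgen_ax a) _; apply: osup_mono.
move=> _ [_ [E SE <-] <-]; exists (gmeet h E); first by exists E.
by rewrite hconj; apply: ole_refl.
Qed.

Let mcommE a : mtot f (p' a) = p (mbase f a).
Proof. by have := congr1 (fun g : lmap _ _ => g a) (mcomm f). Qed.

Let S' (S : set (bbase p' * btot p')) : set (bbase p * btot p) :=
  [set (mbase f x.1, mtot f x.2) | x in S].

Lemma isup_map S : mtot f (isup S) = isup (S' S).
Proof.
rewrite inv_sup; congr osup; rewrite !image_comp.
by apply: eq_imagel => x _ /=; rewrite inv_meet mcommE.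
Qed.

Lemma idirected_map S : idirected S -> idirected (S' S).
Proof.
move=> [h1 h2]; split.
  have := inv_mono (mbase f) h1; rewrite inv_top => k; apply: ole_trans k _.
  rewrite inv_sup; apply: osup_mono => _ [a [U SU] <-].
  exists (mbase f a); last exact: ole_refl.
  by exists (mtot f U), (a, U).
move=> a0 U0 b0 V0 [[a U] SU [<- <-]] [[b V] SV [<- <-]] /=.
rewrite -inv_meet; apply: ole_trans (inv_mono _ (h2 _ _ _ _ SU SV)) _.
rewrite inv_sup; apply: osup_mono => _ [c [cab [d [W [SW cd UW VW]]]] <-].
exists (mbase f c); last exact: ole_refl.
split; first exact: inv_mono.
exists (mbase f d), (mtot f W); rewrite -mcommE -!inv_meet.
by split; [exists (d, W)|apply: inv_mono..].
Qed.

Lemma valMap_sound F SS : valAx F SS -> ole (gmeet h F) (gjoin h SS).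
Proof.
case=> {F SS} [F SS a|U q q' qq'|U q|U q q0|q q0|U V q r|U V q r|S q dS|S q a U dS SU].
- by apply: (homAx_sound (f := lcomp (mbase f) (valProj p))) a.
- by apply: himg; rewrite image_set1; apply: ValDown.
- by apply: himg; rewrite image_comp; apply: ValOpen.
- by apply: himg; rewrite image_set1; apply: ValNneg.
- by apply: himg; rewrite image_set0 /= inv_bot; apply: ValBot.
- apply: himg; rewrite image_comp.
  have := @ValModl p (mtot f U) (mtot f V) q r.
  by rewrite -inv_join -inv_meet.
- apply: himg; rewrite image_comp /= inv_join inv_meet.
  exact: ValModr.
- apply: himg; rewrite image_comp /= isup_map.
  have := ValSup q (idirected_map dS).
  by rewrite image_comp.
- apply: himg; rewrite image_set1 /= isup_map.
  by apply: ValSub (idirected_map dS) _; exists (a, U).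
Qed.

Definition valMap : lmap (valLoc p) (valLoc p') := presMap valMap_sound.

Lemma valMap_base a : valMap (valProj p' a) = valProj p (mbase f a).
Proof. exact: (presMap_gen valMap_sound (gb a)). Qed.

Lemma valMap_vgt U q : valMap (vgt U q) = vgt (mtot f U) q.
Proof. exact: (presMap_gen valMap_sound (gt U q)). Qed.

End ValMap.

Definition valPtLoc (X : locale) : locale := valLoc (Bundle (toPt X)).

Definition trivBundle (A : locale) (I : Type) : bundle :=
  Bundle (@lfst A (discLoc I)).

(* The comparison A x V(I) -> V_A(A x I) for a discrete locale I.  For an open U
   of A x I write U_i for its slice at i; then "m(U) > q" pulls back to the join
   over finite F in I of (/\_(i in F) U_i) x "m(F) > q". *)
Section TrivVal.
Variables (A : locale) (I : Type).
Let p := trivBundle A I.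
Let AV := prodLoc A (valPtLoc (discLoc I)).

Definition slice (i : I) : lmap A (btot p) :=
  lpair (lid A) (lcomp (discMap (fun _ : unit => i)) (toPt A)).

Definition slices (F : seq I) (U : btot p) : A := gmeet (fun i => slice i U) F.

Definition lset (F : seq I) : discLoc I := [set i | List.In i F].

Let vF (F : seq I) (q : rat) : AV := lsnd (vgt (p := Bundle (toPt (discLoc I))) (lset F) q).

Let h (g : valGen p) : AV :=
  match g with
  | inl a => lfst a
  | inr (U, q) => osup (range (fun F : seq I => omeet (lfst (slices F U)) (vF F q)))
  end.

Lemma slice_proj i a : slice i (p a) = a.
Proof. exact: lpair_fst. Qed.

Lemma slices_le F U a : ole a (slices F U) <-> forall i, List.In i F -> ole a (slice i U).
Proof. exact: conj_le. Qed.

Lemma slices_mem F U i : List.In i F -> ole (slices F U) (slice i U).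
Proof. by move: i; apply/slices_le/ole_refl. Qed.

Lemma slices_cons i F U : slices (i :: F) U = omeet (slice i U) (slices F U).
Proof. by []. Qed.

Lemma slices_join U V F : ole (slices F (ojoin U V))
  (osup [set omeet (slices x.1 U) (slices x.2 V)
    | x in [set x | List.incl F (x.1 ++ x.2)]]).
Proof.
elim: F => [|i F IH].
  apply: (ole_trans (V := omeet (slices [::] U) (slices [::] V))).
    by apply: omeet_glb; apply: ole_top.
  by apply: osup_ub; exists ([::], [::]).
rewrite slices_cons; apply: (ole_trans (omeet_mono (ole_refl _) IH)).
apply: omeet_sup_le => _ [[F1 F2] F12 <-].
rewrite (inv_join (slice i)).
have s x y : ole (omeet x y) (omeet y x) by apply: omeet_glb; [apply: omeetr|apply: omeetl].
apply: ole_trans (s _ _ _) _; apply: omeet_sup_le => _ [->|->].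
  apply: (ole_trans (V := omeet (slices (i :: F1) U) (slices F2 V))).
    apply: omeet_glb; last exact: ole_trans (omeetl _ _) (omeetr _ _).
    apply: omeet_glb; first exact: omeetr.
    exact: ole_trans (omeetl _ _) (omeetl _ _).
  apply: osup_ub; exists (i :: F1, F2) => //=.
  by move=> j [<-|/F12]; [left|right].
apply: (ole_trans (V := omeet (slices F1 U) (slices (i :: F2) V))).
  apply: omeet_glb; first exact: ole_trans (omeetl _ _) (omeetl _ _).
  apply: omeet_glb; first exact: omeetr.
  exact: ole_trans (omeetl _ _) (omeetr _ _).
apply: osup_ub; exists (F1, i :: F2) => //=.
move=> j; rewrite List.in_app_iff /=; move=> [<-|/F12]; first by tauto.
by rewrite List.in_app_iff; tauto.
Qed.

Lemma slices_isup S F : idirected (p := p) S -> ole (slices F (isup S))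
  (osup [set omeet x.1 (slices F x.2) | x in S]).
Proof.
move=> [S1 S2]; elim: F => [|i F IH].
  apply: ole_trans S1 _; apply: osup_mono => a [U SU].
  exists (omeet a (slices [::] U)); first by exists (a, U).
  by apply: omeet_glb; [apply: ole_refl|apply: ole_top].
rewrite slices_cons; apply: (ole_trans (omeet_mono (ole_refl _) IH)).
apply: omeet_sup_le => _ [[b V] SV <-].
rewrite (inv_sup (slice i)).
have s x y : ole (omeet x y) (omeet y x) by apply: omeet_glb; [apply: omeetr|apply: omeetl].
apply: ole_trans (s _ _ _) _; apply: omeet_sup_le => _ [_ [[a U] SU <-] <-].
rewrite (inv_meet (slice i)) slice_proj.
set X := omeet _ _.
have Xb : ole X b by exact: ole_trans (omeetl _ _) (omeetl _ _).
have XV : ole X (slices F V) by exact: ole_trans (omeetl _ _) (omeetr _ _).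
have Xa : ole X a by exact: ole_trans (omeetr _ _) (omeetl _ _).
have XU : ole X (slice i U) by exact: ole_trans (omeetr _ _) (omeetr _ _).
apply: (ole_trans (V := omeet X (omeet a b))).
  by apply: omeet_glb; [apply: ole_refl|apply: omeet_glb].
apply: ole_trans (omeet_mono (ole_refl _) (S2 _ _ _ _ SU SV)) _.
apply: omeet_sup_le => c [_ [d [W [SW cd UW VW]]]].
have Xc T U0 V0 : ole (omeet (p c) U0) V0 -> ole T (slice i U0) -> True by [].
have sl j U0 : ole (omeet (p c) U0) W -> ole (omeet c (slice j U0)) (slice j W).
  by move=> /(inv_mono (slice j)); rewrite inv_meet slice_proj.
apply: (ole_trans (V := omeet d (slices (i :: F) W))).
  apply: omeet_glb; first exact: ole_trans (omeetr _ _) cd.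
  apply: omeet_glb.
    apply: ole_trans (sl i U UW); apply: omeet_glb; first exact: omeetr.
    exact: ole_trans (omeetl _ _) XU.
  apply/slices_le => j jF; apply: ole_trans (sl j V VW).
  apply: omeet_glb; first exact: omeetr.
  exact: ole_trans (omeetl _ _) (ole_trans XV (slices_mem _ jF)).
by apply: osup_ub; exists (d, W).
Qed.

Let q0 := Bundle (toPt (discLoc I)).

Let vF_ax F SS : valAx (p := q0) F SS ->
  ole (gmeet (fun g => lsnd (pgen (@valAx q0) g) : AV) F)
      (gjoin (fun g => lsnd (pgen (@valAx q0) g) : AV) SS).
Proof.
move=> a; have := inv_mono (@lsnd A (valPtLoc (discLoc I))) (pgen_ax a).
by rewrite inv_gmeet inv_gjoin.
Qed.

Let h_ub U q F (Z : AV) :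
  ole Z (lfst (slices F U)) -> ole Z (vF F q) -> ole Z (h (gt U q)).
Proof.
move=> h1 h2; apply: ole_trans (osup_ub (imageT _ F)).
exact: omeet_glb.
Qed.

Let h_le U q (Z : AV) :
  (forall F, ole (omeet (lfst (slices F U)) (vF F q)) Z) -> ole (h (gt U q)) Z.
Proof. by move=> k; apply/osup_le => _ [F _ <-]. Qed.

Let vF_mono F (W : discLoc I) q : ole (lset F) W ->
  ole (vF F q) (lsnd (vgt (p := q0) W q)).
Proof. by move=> FW; apply: inv_mono; apply: vgt_mono. Qed.

Let vF_ge F (W : discLoc I) q : ole W (lset F) ->
  ole (lsnd (vgt (p := q0) W q)) (vF F q).
Proof. by move=> FW; apply: inv_mono; apply: vgt_mono. Qed.

Let conj2 (X : locale) G (k : G -> X) g g' : gmeet k [:: g; g'] = omeet (k g) (k g').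
Proof.
apply: ole_anti.
  apply: omeet_mono; first exact: ole_refl.
  exact: omeetl.
apply: omeet_mono; first exact: ole_refl.
by apply: omeet_glb; [apply: ole_refl|apply: ole_top].
Qed.

Let h_le2 U q V r (Z : AV) :
  (forall F E, ole (omeet (omeet (lfst (slices F U)) (vF F q))
                          (omeet (lfst (slices E V)) (vF E r))) Z) ->
  ole (gmeet h [:: gt U q; gt V r]) Z.
Proof.
have s (x y : AV) : ole (omeet x y) (omeet y x).
  by apply: omeet_glb; [apply: omeetr|apply: omeetl].
move=> k; rewrite conj2; apply: omeet_sup_le => _ [E _ <-].
apply: ole_trans (s _ _) _; apply: omeet_sup_le => _ [F _ <-].
by apply: ole_trans (s _ _) _.
Qed.

Lemma trivVal_sound F SS : valAx F SS -> ole (gmeet h F) (gjoin h SS).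
Proof.
case=> {F SS} [F SS a|U q q' qq'|U q|U q q1|q q1|U V q r|U V q r|S q dS|S q a U dS SU].
- by apply: (homAx_sound (f := lfst)) a.
- rewrite disj1 !conj1; apply: h_le => F; apply: h_ub (omeetl _ _) _.
  apply: ole_trans (omeetr _ _) _.
  by have := vF_ax (ValDown (p := q0) (lset F) qq'); rewrite disj1 !conj1.
- rewrite conj1; apply: h_le => F.
  have := vF_ax (ValOpen (p := q0) (lset F) q); rewrite conj1 => k.
  apply: ole_trans (omeet_mono (ole_refl _) k) _.
  apply: omeet_sup_le => _ [_ [q' qq' <-] <-]; rewrite conj1.
  apply: (ole_trans (V := h (gt U q'))).
    by apply: (h_ub (F := F)); [apply: omeetl|apply: omeetr].
  by apply: osup_ub; exists [:: gt U q']; [exists q'|rewrite conj1].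
- rewrite disj1 conj1; apply: (h_ub (F := [::])).
    by rewrite inv_top; apply: ole_top.
  by have := vF_ax (ValNneg (p := q0) (lset [::]) q1); rewrite disj1 conj1.
- rewrite conj1; apply: h_le => -[|i F].
    apply: ole_trans (omeetr _ _) _.
    have k0 : ole (vF [::] q) (lsnd (vgt (p := q0) obot q)) by apply: vF_mono.
    apply: ole_trans k0 _; have := vF_ax (ValBot q0 q1); rewrite conj1 => k; apply: ole_trans k _.
    by apply/osup_le => U [F []].
  apply: ole_trans (omeetl _ _) _.
  apply: (ole_trans (V := lfst obot)).
    by apply: inv_mono; apply: ole_trans (omeetl _ _) _; rewrite inv_bot; apply: ole_refl.
  by rewrite inv_bot; apply: obot_le.
- apply: h_le2 => F E; set P := omeet _ _.
  have PF : ole P (lfst (slices F U)) by exact: ole_trans (omeetl _ _) (omeetl _ _).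
  have PE : ole P (lfst (slices E V)) by exact: ole_trans (omeetr _ _) (omeetl _ _).
  have := vF_ax (ValModl (p := q0) (lset F) (lset E) q r); rewrite conj2 => k.
  apply: (ole_trans (V := omeet P (omeet (vF F q) (vF E r)))).
    apply: omeet_glb; first exact: ole_refl.
    by apply: omeet_glb; [apply: ole_trans (omeetl _ _) (omeetr _ _)
                         |apply: ole_trans (omeetr _ _) (omeetr _ _)].
  apply: ole_trans (omeet_mono (ole_refl _) k) _.
  apply: omeet_sup_le => _ [_ [x xqr <-] <-]; rewrite conj2.
  set L := lsnd _; set R := lsnd _.
  apply: (ole_trans (V := gmeet h [:: gt (ojoin U V) x.1; gt (omeet U V) x.2])); last first.
    apply: osup_ub.
    by exists [:: gt (ojoin U V) x.1; gt (omeet U V) x.2] => //; exists x.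
  rewrite conj2; apply: omeet_glb.
    apply: (h_ub (F := F ++ E)); last first.
      apply: ole_trans (omeetr _ _) _; apply: ole_trans (omeetl _ _) _.
      apply: vF_ge; apply: ojoin_lub => i iF; apply/List.in_app_iff; by [left|right].
    apply: ole_trans (omeetl _ _) _.
    apply: (ole_trans (V := lfst (omeet (slices F U) (slices E V)))).
      by rewrite inv_meet; apply: omeet_glb.
    apply: inv_mono; apply/slices_le => i /List.in_app_iff[iF|iE].
      apply: ole_trans (omeetl _ _) _; apply: ole_trans (slices_mem _ iF) _.
      by apply: inv_mono; apply: ojoinl.
    apply: ole_trans (omeetr _ _) _; apply: ole_trans (slices_mem _ iE) _.
    by apply: inv_mono; apply: ojoinr.
  pose FE := List.filter (fun i => `[< List.In i E >]) F.
  apply: (h_ub (F := FE)); last first.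
    apply: ole_trans (omeetr _ _) _; apply: ole_trans (omeetr _ _) _.
    by apply: vF_ge => i [iF iE]; apply/List.filter_In; split=> //; apply/asboolP.
  apply: ole_trans (omeetl _ _) _.
  apply: (ole_trans (V := lfst (omeet (slices F U) (slices E V)))).
    by rewrite inv_meet; apply: omeet_glb.
  apply: inv_mono; apply/slices_le => i /List.filter_In[iF /asboolP iE].
  rewrite inv_meet; apply: omeet_mono; exact: slices_mem.
- apply: h_le2 => F E; set P := omeet _ _.
  have PF : ole P (lfst (slices F (ojoin U V))) by exact: ole_trans (omeetl _ _) (omeetl _ _).
  have PE : ole P (lfst (slices E (omeet U V))) by exact: ole_trans (omeetr _ _) (omeetl _ _).
  have Pq : ole P (vF F q) by exact: ole_trans (omeetl _ _) (omeetr _ _).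
  have Pr : ole P (vF E r) by exact: ole_trans (omeetr _ _) (omeetr _ _).
  apply: (ole_trans (V := omeet P (lfst (slices F (ojoin U V))))).
    by apply: omeet_glb => //; apply: ole_refl.
  apply: ole_trans (omeet_mono (ole_refl _) (inv_mono lfst (slices_join U V F))) _.
  rewrite (inv_sup lfst); apply: omeet_sup_le => _ [_ [[F1 F2] F12 <-] <-].
  rewrite [(F1, F2).1]/= [(F1, F2).2]/= in F12 *.
  set Q := omeet _ _.
  have QP : ole Q P by exact: omeetl.
  have Q12 : ole Q (lfst (omeet (slices F1 U) (slices F2 V))) by exact: omeetr.
  have := vF_ax (ValModr (p := q0) (lset (F1 ++ E)) (lset (F2 ++ E)) q r).
  rewrite conj2 => k.
  apply: (ole_trans (V := omeet Q (omeet
      (lsnd (vgt (p := q0) (ojoin (lset (F1 ++ E)) (lset (F2 ++ E))) q))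
      (lsnd (vgt (p := q0) (omeet (lset (F1 ++ E)) (lset (F2 ++ E))) r))))).
    apply: omeet_glb; first exact: ole_refl.
    apply: omeet_glb.
      apply: ole_trans QP _; apply: ole_trans Pq _; apply: vF_mono => i /F12.
      move=> /List.in_app_iff[i1|i2].
        by exists (lset (F1 ++ E)); [left|apply/List.in_app_iff; left].
      by exists (lset (F2 ++ E)); [right|apply/List.in_app_iff; left].
    apply: ole_trans QP _; apply: ole_trans Pr _; apply: vF_mono => i iE.
    by split; apply/List.in_app_iff; right.
  apply: ole_trans (omeet_mono (ole_refl _) k) _.
  apply: omeet_sup_le => _ [_ [x xqr <-] <-]; rewrite conj2.
  apply: (ole_trans (V := gmeet h [:: gt U x.1; gt V x.2])); last first.
    by apply: osup_ub; exists [:: gt U x.1; gt V x.2] => //; exists x.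
  have QE : ole Q (lfst (slices E (omeet U V))) by exact: ole_trans QP PE.
  have Qm : ole Q (lfst (omeet (omeet (slices F1 U) (slices F2 V))
                               (slices E (omeet U V)))).
    by rewrite (inv_meet lfst (omeet (slices F1 U) (slices F2 V))); apply: omeet_glb.
  rewrite conj2; apply: omeet_glb.
    apply: (h_ub (F := F1 ++ E)); last exact: ole_trans (omeetr _ _) (omeetl _ _).
    apply: ole_trans (omeetl _ _) _; apply: ole_trans Qm _.
    apply: inv_mono; apply/slices_le => i /List.in_app_iff[i1|iE].
      apply: ole_trans (omeetl _ _) _; apply: ole_trans (omeetl _ _) _.
      exact: slices_mem.
    apply: ole_trans (omeetr _ _) _; apply: ole_trans (slices_mem _ iE) _.
    by apply: inv_mono; apply: omeetl.
  apply: (h_ub (F := F2 ++ E)); last exact: ole_trans (omeetr _ _) (omeetr _ _).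
  apply: ole_trans (omeetl _ _) _; apply: ole_trans Qm _.
  apply: inv_mono; apply/slices_le => i /List.in_app_iff[i2|iE].
    apply: ole_trans (omeetl _ _) _; apply: ole_trans (omeetr _ _) _.
    exact: slices_mem.
  apply: ole_trans (omeetr _ _) _; apply: ole_trans (slices_mem _ iE) _.
  by apply: inv_mono; apply: omeetr.
- rewrite conj1; apply: h_le => F.
  have s (x y : AV) : ole (omeet x y) (omeet y x).
    by apply: omeet_glb; [apply: omeetr|apply: omeetl].
  apply: ole_trans (omeet_mono (inv_mono lfst (slices_isup F dS)) (ole_refl _)) _.
  apply: ole_trans (s _ _) _; rewrite (inv_sup lfst).
  apply: omeet_sup_le => _ [_ [[a U] SU <-] <-].
  apply: (ole_trans (V := gmeet h [:: gb a; gt U q])); last first.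
    by apply: osup_ub; exists [:: gb a; gt U q] => //; exists (a, U).
  rewrite conj2 (inv_meet lfst); apply: omeet_glb.
    exact: ole_trans (omeetr _ _) (omeetl _ _).
  apply: (h_ub (F := F)); last exact: omeetl.
  exact: ole_trans (omeetr _ _) (omeetr _ _).
- rewrite disj1 conj2 conj1; apply: omeet_sup_le => _ [F _ <-].
  apply: (h_ub (F := F)); last exact: ole_trans (omeetr _ _) (omeetr _ _).
  apply: (ole_trans (V := lfst (omeet a (slices F U)))).
    rewrite (inv_meet lfst); apply: omeet_mono; first exact: ole_refl.
    exact: omeetl.
  apply: inv_mono; apply/slices_le => i iF.
  apply: (ole_trans (V := slice i (omeet (p a) U))).
    rewrite inv_meet slice_proj; apply: omeet_mono; first exact: ole_refl.
    exact: slices_mem.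
  by apply: inv_mono; apply: osup_ub; exists (a, U).
Qed.

Definition trivVal : lmap AV (valLoc p) := presMap trivVal_sound.

Lemma trivVal_base a : trivVal (valProj p a) = lfst a.
Proof. exact: (presMap_gen trivVal_sound (gb a)). Qed.

Lemma trivVal_vgt U q :
  trivVal (vgt U q) = osup (range (fun F : seq I =>
    omeet (lfst (slices F U))
          (lsnd (vgt (p := Bundle (toPt (discLoc I))) (lset F) q)))).
Proof. exact: (presMap_gen trivVal_sound (gt U q)). Qed.

End TrivVal.

Local Open Scope ring_scope.

Definition directed (X : locale) (S : set X) : Prop :=
  S !=set0 /\
  forall U V, S U -> S V -> exists W, [/\ S W, ole U W & ole V W].

(* Valuations; classically, the lower reals [0, oo] are the nonnegative
   extended reals. *)
Record valuation (R : realType) (X : locale) := Valuation {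
  val_fun :> X -> \bar R;
  val_ge0 : forall U, (0 <= val_fun U)%E;
  val_bot : val_fun obot = 0%E;
  val_mod : forall U V,
    (val_fun (ojoin U V) + val_fun (omeet U V) = val_fun U + val_fun V)%E;
  val_scott : forall S, directed S ->
    val_fun (osup S) = ereal_sup [set val_fun U | U in S] }.

Lemma valuation_ext (R : realType) (X : locale) (m m' : valuation R X) :
  (forall U, m U = m' U) -> m = m'.
Proof.
case: m => m m1 m2 m3 m4; case: m' => m' k1 k2 k3 k4 /= h.
have E : m = m' by apply: funext.
by subst m'; congr Valuation; apply: Prop_irrelevance.
Qed.

(* Push-forward V(f). *)
Program Definition pushVal (R : realType) (X Y : locale) (f : lmap X Y)
    (m : valuation R X) : valuation R Y :=
  @Valuation R Y (fun V => m (f V)) _ _ _ _.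
Next Obligation. by move=> R X Y f m U; apply: val_ge0. Qed.
Next Obligation. by move=> R X Y f m /=; rewrite inv_bot val_bot. Qed.
Next Obligation. by move=> R X Y f m U V; rewrite /= inv_join inv_meet val_mod. Qed.
Next Obligation.
move=> R X Y f m S [[U0 SU0] dS]; rewrite /= inv_sup val_scott ?image_comp//.
split; first by exists (f U0), U0.
move=> _ _ [U SU <-] [V SV <-]; have [W [SW UW VW]] := dS U V SU SV.
by exists (f W); split; [exists W|apply: inv_mono..].
Qed.

(* The valuation on a finite discrete set with given values on elements. *)
Section DiscVal.
Variables (R : realType) (I : finType) (w : I -> R) (w0 : forall i, 0 <= w i).

Let m (U : set I) : R := \sum_(i | `[< U i >]) w i.

Let m_mono U V : U `<=` V -> m U <= m V.
Proof.
move=> UV; rewrite /m [leRHS](bigID (fun i => `[< U i >])) /=.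
rewrite -[leLHS]addr0 lerD ?sumr_ge0//.
rewrite le_eqVlt; apply/orP; left; apply/eqP; apply: eq_bigl => i.
by apply/asboolP/andP => [Ui|[_ /asboolP]//]; split; apply/asboolP => //; apply: UV.
Qed.

Let m_if U : m U = \sum_i (if `[< U i >] then w i else 0).
Proof. by rewrite /m big_mkcond. Qed.

Let m_bot : m (obot : discLoc I) = 0.
Proof. by rewrite m_if big1// => i _; case: asboolP => // -[]. Qed.

Let m_mod (U V : discLoc I) : m (ojoin U V) + m (omeet U V) = m U + m V.
Proof.
rewrite !m_if -!big_split; apply: eq_bigr => i _.
have -> : `[< ojoin U V i >] = `[< U i >] || `[< V i >].
  apply/asboolP/orP => [[W [->|->] Wi]|[/asboolP Ui|/asboolP Vi]].
  - by left; apply/asboolP.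
  - by right; apply/asboolP.
  - by exists U => //; left.
  - by exists V => //; right.
have -> : `[< omeet U V i >] = `[< U i >] && `[< V i >].
  by apply/asboolP/andP => [[Ui Vi]|[/asboolP Ui /asboolP Vi]]; split => //; apply/asboolP.
by case: `[< U i >]; case: `[< V i >]; rewrite /= ?addr0 ?add0r.
Qed.

Program Definition discVal : valuation R (discLoc I) :=
  @Valuation R (discLoc I) (fun U : set I => (m U)%:E) _ _ _ _.
Next Obligation. by move=> U; rewrite lee_fin sumr_ge0. Qed.
Next Obligation. by congr _%:E; apply: m_bot. Qed.
Next Obligation. by move=> U V; congr _%:E; apply: m_mod. Qed.
Next Obligation.
move=> S [[U0 SU0] dS].
have [V SV hV] : exists2 V, S V & osup S `<=` V.
  suff [V SV h] : exists2 V, S V & forall i, i \in enum I -> osup S i -> V i.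
    by exists V => // i Si; apply: h => //; rewrite mem_enum.
  elim: (enum I) => [|i s [V SV h]]; first by exists U0.
  have [[U SU Ui]|nSi] := pselect (osup S i).
    have [W [SW UW VW]] := dS U V SU SV; exists W => // j.
    by rewrite inE => /orP[/eqP-> _|js Sj]; [apply: UW|apply: VW; apply: h].
  exists V => // j; rewrite inE => /orP[/eqP->|]; first by move/nSi.
  exact: h.
apply/le_anti/andP; split.
  apply: (@le_trans _ _ (m V)%:E); first by rewrite lee_fin m_mono.
  by apply: ereal_sup_ubound; exists V.
apply: ge_ereal_sup => _ [U SU <-]; rewrite lee_fin; apply: m_mono.
by move=> i Ui; exists U.
Qed.

Lemma discVal1 i : discVal [set i] = (w i)%:E.
Proof.
congr _%:E; rewrite /m (big_pred1 i) // => j.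
by apply/asboolP/eqP => [->|->].
Qed.

End DiscVal.

Lemma ratr_lt_split (R : realType) (x y : \bar R) (t : rat) : (0 <= x)%E -> (0 <= y)%E ->
  ((ratr t : R)%:E < x + y)%E ->
  exists z : rat * rat, [/\ z.1 + z.2 = t, ((ratr z.1 : R)%:E < x)%E &
    ((ratr z.2 : R)%:E < y)%E].
Proof.
move=> x0 y0.
case: x x0 => [x| |] // x0; last first.
  move=> _; exists (t + 1, -1); split => /=; first by rewrite addrK.
    exact: ltry.
  by apply: lt_le_trans y0; rewrite lte_fin rmorphN rmorph1 ltrN10.
case: y y0 => [y| |] // y0; last first.
  move=> _; exists (-1, t + 1); split => /=; first by rewrite addrC addrK.
    by apply: lt_le_trans x0; rewrite lte_fin rmorphN rmorph1 ltrN10.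
  exact: ltry.
rewrite -EFinD lte_fin -ltrBlDr => /rat_in_itvoo[q]; rewrite in_itv /= => /andP[h k].
exists (q, t - q); split => /=; first by rewrite addrC subrK.
  by rewrite lte_fin.
by rewrite lte_fin rmorphB /= ltrBlDr addrC -ltrBlDr.
Qed.

Lemma ratr_lt_add (R : realType) (x y : \bar R) (q r : rat) : (0 <= x)%E -> (0 <= y)%E ->
  ((ratr q : R)%:E < x)%E -> ((ratr r : R)%:E < y)%E ->
  ((ratr (q + r) : R)%:E < x + y)%E.
Proof. by move=> x0 y0 qx ry; rewrite rmorphD /= EFinD lteD. Qed.

(* The point of the locale V(X) given by a valuation m. *)
Section ValPoint.
Variables (R : realType) (X : locale) (m : valuation R X).
Let p : bundle := Bundle (toPt X).

Definition valPtGen (g : valGen p) : ptLoc :=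
  match g with
  | inl P => P
  | inr (U, q) => [set _ | ((ratr q : R)%:E < m U)%E]
  end.

Let val_mono U V : ole U V -> (m U <= m V)%E.
Proof.
move=> UV; pose S := [set W | W = U \/ W = V].
have dS : directed S.
  split; first by exists U; left.
  have h W : S W -> ole W V by move=> [->|->] //; apply: ole_refl.
  by move=> W W' /h WV /h W'V; exists V; split=> //; right.
have E : osup S = V by apply: ole_anti; [apply: ojoin_lub => //; apply: ole_refl|apply: ojoinr].
by rewrite -E val_scott//; apply: ereal_sup_ubound; exists U => //; left.
Qed.

Let conj_pt F : gmeet valPtGen F tt <-> forall g, List.In g F -> valPtGen g tt.
Proof.
elim: F => [|g F IH] /=; first by [].
split=> [[hg /IH hF] g' [<-//|]|H]; first exact: hF.
by split; [apply: H; left|apply/IH => g' g'F; apply: H; right].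
Qed.

Let model F SS :
  (gmeet valPtGen F tt -> exists2 E, SS E & gmeet valPtGen E tt) ->
  ole (gmeet valPtGen F) (gjoin valPtGen SS).
Proof.
move=> h [] /h[E SE kE]; exists (gmeet valPtGen E) => //.
by exists E.
Qed.

Let toPtT (P : ptLoc) : P tt -> toPt X P = otop.
Proof. by move=> Pt; apply: ole_anti; [apply: ole_top|apply: osup_ub]. Qed.

Lemma isup_pt (S : set (bbase p * btot p)) : idirected S ->
  let D := [set U | exists2 P, S (P, U) & P tt] in
  directed D /\ isup S = osup D.
Proof.
move=> [S1 S2] D; split; first split.
- by have [P [U SU] Pt] := S1 tt I; exists U, P.
- move=> U V [P SU Pt] [Q SV Qt].
  have [c [_ [d [W [SW cd UW VW]]]] ct] := S2 _ _ _ _ SU SV tt (conj Pt Qt).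
  have E : p c = otop by apply: toPtT.
  rewrite E in UW VW.
  exists W; split; first by exists d => //; apply: cd.
    by apply: ole_trans UW; apply: omeet_glb;
      [apply: ole_top|apply: ole_refl].
  by apply: ole_trans VW; apply: omeet_glb;
    [apply: ole_top|apply: ole_refl].
- apply: ole_anti; apply/osup_le.
    move=> _ [[P U] SU <-]; have s (x y : X) : ole (omeet x y) (omeet y x).
      by apply: omeet_glb; [apply: omeetr|apply: omeetl].
    apply: ole_trans (s _ _) _; apply: omeet_sup_le => V Pt.
    by apply: ole_trans (omeetl _ _) _; apply: osup_ub; exists P.
  move=> U [P SU Pt]; apply: (ole_trans (V := omeet (p P) U)).
    have -> : p P = otop by apply: toPtT.
    by apply: omeet_glb; [apply: ole_top|apply: ole_refl].
  by apply: osup_ub; exists (P, U).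
Qed.

Lemma valPt_sound F SS : valAx F SS -> ole (gmeet valPtGen F) (gjoin valPtGen SS).
Proof.
case=> {F SS} [F SS a|U q q' qq'|U q|U q q1|q q1|U V q r|U V q r|S q dS|S q a U dS SU].
- by apply: (homAx_sound (f := lid ptLoc)) a.
- apply: model => -[h _]; exists [:: gt (p := p) U q] => //; split=> //.
  by apply: le_lt_trans h; rewrite lee_fin ler_rat.
- apply: model => -[h _].
  have [q' qq' h'] : exists2 q' : rat, q < q' & ((ratr q' : R)%:E < m U)%E.
    move: h; rewrite /valPtGen /=; case: (m U) => [x| |] //=.
      rewrite lte_fin => /rat_in_itvoo[q']; rewrite in_itv /= ltr_rat => /andP[h k].
      by exists q'.
    by exists (q + 1); [rewrite ltrDl|exact: ltry].
  by exists [:: gt (p := p) U q']; [exists q'|].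
- apply: model => _; exists [:: gt (p := p) U q] => //; split=> //.
  by apply: lt_le_trans (val_ge0 m U); rewrite lte_fin -[ltRHS](rmorph0 (@ratr R)) ltr_rat.
- apply: model => -[] /=; rewrite val_bot lte_fin -[ltRHS](rmorph0 (@ratr R)) ltr_rat.
  by rewrite ltNge q1.
- apply: model => -[h1 [h2 _]].
  have := ratr_lt_add (val_ge0 m U) (val_ge0 m V) h1 h2; rewrite -val_mod.
  case/(ratr_lt_split (val_ge0 m _) (val_ge0 m _)) => z [z1 z2 z3].
  by exists [:: gt (p := p) (ojoin U V) z.1; gt (p := p) (omeet U V) z.2]; [exists z|].
- apply: model => -[h1 [h2 _]].
  have := ratr_lt_add (val_ge0 m _) (val_ge0 m _) h1 h2; rewrite val_mod.
  case/(ratr_lt_split (val_ge0 m _) (val_ge0 m _)) => z [z1 z2 z3].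
  by exists [:: gt (p := p) U z.1; gt (p := p) V z.2]; [exists z|].
- apply: model => -[h _]; have [dD E] := isup_pt dS.
  move: h; rewrite /valPtGen /= E val_scott// => /ereal_sup_gt[_ [U [P SU Pt] <-] h].
  by exists [:: gb (p := p) P; gt (p := p) U q]; [exists (P, U)|].
- apply: model => -[Pt [h _]]; exists [:: gt (p := p) (isup S) q] => //; split=> //.
  apply: lt_le_trans h _; apply: val_mono; have [_ ->] := isup_pt dS.
  by apply: osup_ub; exists a.
Qed.

Definition valPoint : lmap ptLoc (valPtLoc X) := presMap valPt_sound.

Lemma valPoint_vgt (U : X) q :
  valPoint (vgt (p := p) U q) = [set _ | ((ratr q : R)%:E < m U)%E].
Proof. exact: (presMap_gen valPt_sound (gt (p := p) U q)). Qed.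

End ValPoint.

(* The locale of a topological space. *)
Program Definition spaceLoc (T : topologicalType) : locale :=
  @Locale {U : set T | open U} (fun U V => sval U `<=` sval V)
    (exist _ setT (@openT T))
    (fun U V => exist _ _ (openI (proj2_sig U) (proj2_sig V)))
    (fun S => exist _ (\bigcup_(U in S) sval U)
                (bigcup_open (fun U _ => proj2_sig U)))
    _ _ _ _ _ _ _.
Next Obligation. by move=> T U x. Qed.
Next Obligation. by move=> T V U W h k; apply: subset_trans h k. Qed.
Next Obligation.
move=> T [U oU] [V oV] /= h k; have E : U = V by apply/seteqP.
by subst V; congr exist; apply: Prop_irrelevance.
Qed.
Next Obligation. by move=> T U x. Qed.
Next Obligation. by move=> T W U V; rewrite /= subsetI. Qed.
Next Obligation.
move=> T S V; split=> [h U SU x Ux|h x [U SU Ux]]; last exact: h Ux.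
by apply: h; exists U.
Qed.
Next Obligation.
move=> T U S x [Ux [V SV Vx]].
exists (exist _ _ (openI (proj2_sig U) (proj2_sig V))); last by [].
by exists V.
Qed.

Program Definition spaceMap (T T' : topologicalType) (f : T -> T')
    (cf : continuous f) : lmap (spaceLoc T) (spaceLoc T') :=
  @Lmap (spaceLoc T) (spaceLoc T')
    (fun V => exist _ (f @^-1` sval V) (open_comp (fun x _ => cf x) (proj2_sig V)))
    _ _ _.
Next Obligation. by move=> T T' f cf; apply: ole_anti. Qed.
Next Obligation. by move=> T T' f cf U V; apply: ole_anti. Qed.
Next Obligation.
move=> T T' f cf S; apply: ole_anti => x /=.
  by move=> [V SV Vx]; eexists; [exists V; [exact: SV|reflexivity]|].
by move=> [_ [V SV <-] Vx]; exists V.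
Qed.

Program Definition spacePt (T : topologicalType) (x : T) : lmap ptLoc (spaceLoc T) :=
  @Lmap ptLoc (spaceLoc T) (fun U => [set _ | sval U x]) _ _ _.
Next Obligation. by []. Qed.
Next Obligation. by []. Qed.
Next Obligation.
move=> T x S; apply/seteqP; split=> u /=.
  by move=> [V SV Vx]; exists [set _ | sval V x] => //; exists V.
by move=> [_ [V SV <-] Vx]; exists V.
Qed.

Local Open Scope sesquilinear_scope.

Section ProjectorSystems.
Variables (R : realType) (n : nat).
Local Notation M := 'M[R[i]]_n.

Definition projector (P : M) : Prop := P ^t* = P /\ P *m P = P.

Record is_projsys (l : nat) (C : 'I_l -> M) : Prop := {
  ps_proj : forall i, projector (C i);
  ps_neq0 : forall i, C i != 0;
  ps_orth : forall i j, i != j -> C i *m C j = 0;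
  ps_complete : \sum_i C i = 1%:M }.

End ProjectorSystems.

(* Ordered partitions of n into positive integers. *)
Record opart (n : nat) := Opart {
  parts :> seq nat;
  parts_gt0 : forall k, k \in parts -> (0 < k)%N;
  parts_sum : sumn parts = n }.

Definition part n (mu : opart n) (i : 'I_(size mu)) : nat := nth 0%N mu i.

Record refinement n (nu mu : opart n) := Refinement {
  ref_fun :> 'I_(size mu) -> 'I_(size nu);
  ref_sum : forall j, part j = (\sum_(i | ref_fun i == j) part i)%N }.

Record projsys (R : realType) n (mu : opart n) := Projsys {
  ps_fun :> 'I_(size mu) -> 'M[R[i]]_n;
  psP : is_projsys ps_fun;
  ps_type : forall i, \tr (ps_fun i) = (part i)%:R }.

Section ProjMap.
Variables (R : realType) (n : nat).
Local Notation M := 'M[R[i]]_n.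

HB.instance Definition _ (mu : opart n) := gen_eqMixin (projsys R mu).
HB.instance Definition _ (mu : opart n) := gen_choiceMixin (projsys R mu).

(* Proj(mu) with the subspace topology; R[i]^o carries the topology of C. *)
Definition Proj (mu : opart n) : topologicalType :=
  initial_topology
    (fun C : projsys R mu => ps_fun C : {ptws 'I_(size mu) -> 'M[(R[i])^o]_n}).

Lemma adjmxM (A B : M) : (A *m B) ^t* = B ^t* *m A ^t*.
Proof. by rewrite trmx_mul map_mxM. Qed.

Lemma adjmx_sum (I : finType) (P : pred I) (F : I -> M) :
  (\sum_(i | P i) F i) ^t* = \sum_(i | P i) (F i) ^t*.
Proof. by rewrite !raddf_sum. Qed.

Lemma ps_mul (mu : opart n) (C : projsys R mu) i j :
  C i *m C j = if i == j then C i else 0.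
Proof.
by case: eqP => [<-|/eqP]; [case: (ps_proj (psP C) i)|apply: (ps_orth (psP C))].
Qed.

Section Coarsen.
Variables (nu mu : opart n) (r : refinement nu mu) (C : projsys R mu).

Definition coarsen (j : 'I_(size nu)) : M := \sum_(i | r i == j) C i.

Lemma coarsen_type j : \tr (coarsen j) = (part j)%:R.
Proof.
by rewrite raddf_sum /= (ref_sum r) natr_sum; apply: eq_bigr => i _; apply: ps_type.
Qed.

Lemma coarsen_mul j j' : coarsen j *m coarsen j' = if j == j' then coarsen j else 0.
Proof.
rewrite /coarsen mulmx_suml.
under eq_bigr => i ri.
  rewrite mulmx_sumr; under eq_bigr do rewrite ps_mul.
  over.
case: eqP => [<-|jj'].
  apply: eq_bigr => i ri; rewrite (bigD1 i)//= eqxx big1 ?addr0// => i' /andP[_].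
  by rewrite eq_sym => /negPf->.
rewrite big1// => i /eqP ri; rewrite big1// => i' /eqP ri'.
by case: eqP => // ii'; case: jj'; rewrite -ri -ri' ii'.
Qed.

Lemma coarsenP : is_projsys coarsen.
Proof.
split=> [j|j|j j' jj'|].
- split; last by rewrite coarsen_mul eqxx.
  by rewrite adjmx_sum; apply: eq_bigr => i _; case: (ps_proj (psP C) i).
- apply/eqP => cj; have := coarsen_type j; rewrite cj mxtrace0 => /esym/eqP.
  rewrite pnatr_eq0 => /eqP pj.
  by have := parts_gt0 (mem_nth 0%N (ltn_ord j)); rewrite -/(part j) pj.
- by rewrite coarsen_mul (negPf jj').
- rewrite -(ps_complete (psP C)) (partition_big r xpredT)//=.
Qed.

Definition projMap : projsys R nu := Projsys coarsenP coarsen_type.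
End Coarsen.

Lemma projMap_continuous (nu mu : opart n) (r : refinement nu mu) :
  continuous (projMap r : Proj mu -> Proj nu).
Proof.
apply: continuous_comp_initial => C.
have FF := fmap_filter (@ps_fun R n nu \o projMap r) (nbhs_filter (C : Proj mu)).
apply/cvg_sup => j; move: C {FF}.
apply: (continuous_comp_initial (w := fun f : 'I_(size nu) -> 'M[(R[i])^o]_n => f j)) => C.
pose ev i (f : {ptws 'I_(size mu) -> 'M[(R[i])^o]_n}) := f i.
have cev i : (ev i \o @ps_fun R n mu) x @[x --> (C : Proj mu)] --> ev i (ps_fun C).
  apply: (@cvg_comp _ _ _ (@ps_fun R n mu) (ev i) _
    (nbhs (ps_fun C : {ptws 'I_(size mu) -> 'M[(R[i])^o]_n}))).
    exact: (@initial_continuous (projsys R mu)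
      {ptws 'I_(size mu) -> 'M[(R[i])^o]_n} (@ps_fun R n mu) C).
  exact: (@proj_continuous 'I_(size mu)
    (fun=> 'M[(R[i])^o]_n : topologicalType) i (ps_fun C)).
have addc := @pseudometric_normed_Zmodule.add_continuous _
  ('M[(R[i])^o]_n : normedModType R[i]).
have := @cvg_big _ _ _ 0 (fun i => r i == j) addc _ (nbhs (C : Proj mu))
  (index_enum 'I_(size mu)) (fun i => ev i \o @ps_fun R n mu) _ _ (fun i _ => cev i).
exact.
Qed.

End ProjMap.

Section Born.
Variables (R : realType) (n : nat).
Local Notation M := 'M[R[i]]_n.

Definition ProjLoc (mu : opart n) : locale := spaceLoc (Proj R mu).

Definition ProjBundle (mu : opart n) : bundle :=
  trivBundle (ProjLoc mu) 'I_(size mu).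

(* A refinement nu -> mu is an arrow mu -> nu of the opposite category, which
   indexes the diagrams. *)
Definition ProjArr (mu nu : opart n) (r : refinement nu mu) :
  lmap (ProjLoc mu) (ProjLoc nu) := spaceMap (@projMap_continuous R n nu mu r).

Definition ProjTotArr (mu nu : opart n) (r : refinement nu mu) :
  lmap (btot (ProjBundle mu)) (btot (ProjBundle nu)) :=
  lprodMap (ProjArr r) (discMap r).

Definition B : locale := laxColim ProjArr.

Definition Sigma : locale := laxColim ProjTotArr.

Definition inB (mu : opart n) : lmap (ProjLoc mu) B := laxIn ProjArr mu.

Definition inSigma (mu : opart n) : lmap (btot (ProjBundle mu)) Sigma :=
  laxIn ProjTotArr mu.

Lemma Sigma_lax (mu nu : opart n) (r : refinement nu mu) :
  spec (lcomp (lcomp (inB nu) (ProjBundle nu)) (ProjTotArr r))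
       (lcomp (inB mu) (ProjBundle mu)).
Proof.
move=> V; have -> : lcomp (lcomp (inB nu) (ProjBundle nu)) (ProjTotArr r) V =
    lfst (ProjArr r (inB nu V)) by apply: lpair_fst.
exact: (inv_mono lfst (@laxIn_spec _ _ _ ProjArr mu nu r V)).
Qed.

Definition Sigma_proj : lmap Sigma B := laxDesc Sigma_lax.

Definition Sigma2 : bundle := Bundle (lprodMap Sigma_proj Sigma_proj).

Section Pair.
Variables mu nu : opart n.

Definition PairBundle : bundle :=
  trivBundle (prodLoc (ProjLoc mu) (ProjLoc nu)) ('I_(size mu) * 'I_(size nu)).

Definition pairFst : lmap (btot PairBundle) (btot (ProjBundle mu)) :=
  lprodMap lfst (discMap fst).

Definition pairSnd : lmap (btot PairBundle) (btot (ProjBundle nu)) :=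
  lprodMap lsnd (discMap snd).

Definition pairTot : lmap (btot PairBundle) (btot Sigma2) :=
  lpair (lcomp (inSigma mu) pairFst) (lcomp (inSigma nu) pairSnd).

Definition pairBase : lmap (bbase PairBundle) (bbase Sigma2) :=
  lprodMap (inB mu) (inB nu).

Lemma pair_comm : lcomp Sigma2 pairTot = lcomp pairBase PairBundle.
Proof.
apply: lpair_ext => U.
- transitivity (pairTot (lfst (Sigma_proj U))).
    by congr (pairTot _); apply: lpair_fst.
  transitivity (pairFst (inSigma mu (Sigma_proj U))).
    exact: lpair_fst.
  transitivity (PairBundle (@lfst (ProjLoc mu) (ProjLoc nu) (inB mu U))).
    exact: lpair_fst.
  by congr (PairBundle _); apply/esym/lpair_fst.
- transitivity (pairTot (lsnd (Sigma_proj U))).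
    by congr (pairTot _); apply: lpair_snd.
  transitivity (pairSnd (inSigma nu (Sigma_proj U))).
    exact: lpair_snd.
  transitivity (PairBundle (@lsnd (ProjLoc mu) (ProjLoc nu) (inB nu U))).
    exact: lpair_fst.
  by congr (PairBundle _); apply/esym/lpair_snd.
Qed.

Definition pairMap : bundleMap PairBundle Sigma2 := BundleMap pair_comm.

Definition pairVal :
  lmap (prodLoc (prodLoc (ProjLoc mu) (ProjLoc nu))
                (valPtLoc (discLoc ('I_(size mu) * 'I_(size nu)))))
       (valLoc Sigma2) :=
  lcomp (valMap pairMap) (trivVal _ _).

Variables (C : projsys R mu) (D : projsys R nu).

Lemma trace_ge0 i j : 0 <= \tr (C i *m D j).
Proof.
have [Cs Ci] := ps_proj (psP C) i; have [Ds Di] := ps_proj (psP D) j.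
have -> : \tr (C i *m D j) = \tr (C i *m D j *m (C i *m D j) ^t* ).
  rewrite adjmxM Cs Ds mulmxA -(mulmxA (C i)) Di [RHS]mxtrace_mulC mulmxA.
  by rewrite Ci.
rewrite /mxtrace sumr_ge0// => a _; rewrite !mxE sumr_ge0// => b _.
by rewrite !mxE mul_conjC_ge0.
Qed.

Definition born_weight (x : 'I_(size mu) * 'I_(size nu)) : R :=
  complex.Re (\tr (C x.1 *m D x.2)).

Lemma born_weight_ge0 x : 0 <= born_weight x.
Proof. by have := trace_ge0 x.1 x.2; rewrite lecE => /andP[]. Qed.

Definition beta : valuation R (discLoc ('I_(size mu) * 'I_(size nu))) :=
  discVal born_weight_ge0.

Definition Born : lmap ptLoc (valLoc Sigma2) :=
  lcomp pairVal (lpair (lpair (spacePt (C : Proj R mu)) (spacePt (D : Proj R nu)))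
                       (valPoint beta)).

End Pair.

Definition ketbra (psi : 'cV[R[i]]_n) : M := psi *m psi ^t*.

(* <psi|P|psi>: the Born rule probability of the projector P in state psi. *)
Definition born_prob (psi : 'cV[R[i]]_n) (P : M) : R[i] :=
  (psi ^t* *m P *m psi) 0 0.

Definition unit_vector (psi : 'cV[R[i]]_n) : Prop := psi ^t* *m psi = 1%:M.

Definition orthonormal_kets (K : nat) (psi : 'I_K -> 'cV[R[i]]_n) : Prop :=
  forall k k', (psi k) ^t* *m psi k' = (k == k')%:R%:M.

End Born.

(* Main.v *)
Require Import Defs.
From mathcomp Require Import all_boot all_order all_algebra.
From mathcomp Require Import complex.
From mathcomp Require Import all_classical all_reals all_analysis.

(** The numerical statements are bilinearity of the trace.  Expanding
    [C = Proj(r)(C')] and [D = Proj(s)(D')] inside [Tr(C_i D_j)] gives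
    [trace_refine], and summing over the elements of a subset turns it into the
    equality [beta_refine] of a Born valuation with a push-forward.  The Born
    rule is [trace_ketbra], and a projector of trace 1 is some [|psi><psi|]
    because a projector of trace 0 vanishes ([projector_tr0]).

    For the specialization order, the locale of relative valuations is presented
    by generators, so two of its points need only be compared on these
    ([spec_presLoc]).  A generator is either an open [a] of the base or a
    condition [m(U) > q], with [U] an open of the product bundle space.

    - On base opens, the Born point of [C, D] restricts to the pair of the images
      of [C] and [D] in [B] ([Born_base]); these lie below the images of [C'] and
      [D'] since the lax colimit imposes exactly that ([spec_inB]).
    - The Born point of [C, D] satisfies [m(U) > q] when some finite set [F] of
      indices [(i, j)] has Born weight above [q] while [U] contains the point
      [(C, i), (D, j)] for each of them ([Born_vgt]).  Take for [C', D'] the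
      preimage [F'] of [F] under [r x s].  It has the same weight, by
      [beta_refine].  And [U] contains [(C', i'), (D', j')] for every [(i', j')]
      in [F'], because that point lies above [(C, r(i')), (D, s(j'))] in the
      specialization order, by the relations that define the bundle space
      ([spec_inSigma]). *)

Local Open Scope classical_set_scope.
Local Open Scope ring_scope.
Local Open Scope sesquilinear_scope.

Import Order.TTheory GRing.Theory Num.Theory.

Set Implicit Arguments.

Lemma mem_In (T : eqType) (x : T) s : x \in s -> List.In x s.
Proof.
by elim: s => // y s IH; rewrite inE => /orP[/eqP->|/IH]; [left|right].
Qed.

(** * Specialization of maps into presented locales *)

Lemma gmeet_mono (X : locale) G (h k : G -> X) F :
  (forall g, ole (h g) (k g)) -> ole (gmeet h F) (gmeet k F).
Proof.
move=> hk; elim: F => [|g F IH] /=; first exact: ole_refl.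
exact: omeet_mono.
Qed.

(** Every open is a join of finite meets of generators, and these operations
    are monotone and preserved by inverse images. *)
Lemma spec_presLoc (X : locale) G (Ax : seq G -> set (seq G) -> Prop)
    (f f' : lmap X (presLoc Ax)) :
  (forall g, ole (f (pgen Ax g)) (f' (pgen Ax g))) -> spec f f'.
Proof.
move=> h J; rewrite [J]disj_pgen !inv_gjoin; apply: osup_mono => _ [F JF <-].
exists (gmeet (f' \o pgen Ax) F); first by exists F.
exact: gmeet_mono.
Qed.

Lemma spec_lpair (Z X Y : locale) (f f' : lmap Z X) (g g' : lmap Z Y) :
  spec f f' -> spec g g' -> spec (lpair f g) (lpair f' g').
Proof.
move=> ff' gg'; apply: spec_presLoc => -[U|V].
  by rewrite -[pgen _ _]/(lfst U) !lpair_fst; apply: ff'.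
by rewrite -[pgen _ _]/(lsnd V) !lpair_snd; apply: gg'.
Qed.

Lemma lpair_lcomp (Z Z' X Y : locale) (f : lmap Z X) (g : lmap Z Y)
    (h : lmap Z' Z) : lcomp (lpair f g) h = lpair (lcomp f h) (lcomp g h).
Proof.
apply: lpair_ext => U; rewrite ?lpair_fst ?lpair_snd; congr (h _).
  exact: lpair_fst.
exact: lpair_snd.
Qed.

Lemma lpair_lprodMap (Z X X' Y Y' : locale) (f : lmap X X') (g : lmap Y Y')
    (x : lmap Z X) (y : lmap Z Y) :
  lcomp (lprodMap f g) (lpair x y) = lpair (lcomp f x) (lcomp g y).
Proof.
rewrite lpair_lcomp; congr lpair; apply: lmap_ext => U.
  exact: lpair_fst.
exact: lpair_snd.
Qed.

(** At a point, slicing an open of the product with a discrete locale at [x]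
    evaluates it at that point paired with [x]. *)
Lemma slice_pt (A : locale) (I : Type) (c : lmap ptLoc A) (x : I) :
  lcomp (slice A x) c = lpair c (discMap (fun=> x)).
Proof.
rewrite lpair_lcomp; congr lpair; apply: lmap_ext => V; first by [].
apply/seteqP; split=> u; case: u => h.
  have {h} : c (osup [set _ | V x]) tt by exact: h.
  by rewrite inv_sup => -[_ [U Vx _] _].
apply: (inv_mono c (osup_ub (_ : [set _ | V x] otop))) => //.
by rewrite inv_top.
Qed.

(** * Projectors and traces *)

Section Traces.
Variables (R : realType) (n : nat).
Local Notation M := 'M[R[i]]_n.

Lemma trace_refine (mu nu mu' nu' : opart n) (C' : projsys R mu')
    (D' : projsys R nu') (r : refinement mu mu') (s : refinement nu nu') i j :
  \tr (projMap r C' i *m projMap s D' j) =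
  \sum_(x : 'I_(size mu') * 'I_(size nu') | (r x.1 == i) && (s x.2 == j))
    \tr (C' x.1 *m D' x.2).
Proof.
rewrite -(pair_big (fun i' => r i' == i) (fun j' => s j' == j)
  (fun i' j' => \tr (C' i' *m D' j'))) /=.
rewrite /coarsen mulmx_suml raddf_sum; apply: eq_bigr => i' _.
by rewrite mulmx_sumr raddf_sum.
Qed.

(** The weight of the preimage of [U] is regrouped by the fibres of [r x s]. *)
Lemma beta_refine (mu nu mu' nu' : opart n) (C' : projsys R mu')
    (D' : projsys R nu') (r : refinement mu mu') (s : refinement nu nu') :
  beta (projMap r C') (projMap s D') =
  pushVal (discMap (fun x => (r x.1, s x.2))) (beta C' D').
Proof.
apply: valuation_ext => U.
pose f x := (r x.1, s x.2).
congr _%:E; rewrite [RHS](partition_big f (fun x => `[< U x >])) //=.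
apply: eq_bigr => -[i j] Uij; rewrite /born_weight trace_refine raddf_sum.
apply: eq_bigl => x; rewrite [in RHS]xpair_eqE; apply/idP/andP => [h|[]//].
by split=> //; case/andP: h => /eqP ri /eqP sj; rewrite /preimage/= ri sj.
Qed.

Lemma trace_ketbra (psi : 'cV[R[i]]_n) (P : M) :
  \tr (ketbra psi *m P) = born_prob psi P.
Proof.
rewrite /ketbra /born_prob -mulmxA mxtrace_mulC; exact: big_ord1.
Qed.

Lemma ketbra_adj (psi : 'cV[R[i]]_n) : (ketbra psi) ^t* = ketbra psi.
Proof.
rewrite /ketbra trmx_mul map_mxM; congr (_ *m _).
by apply/matrixP => a b; rewrite !mxE /= conjCK.
Qed.

(** The trace of [P = P P^*] is the sum of the squared moduli of the entries. *)
Lemma projector_tr0 (P : M) : projector P -> \tr P = 0 -> P = 0.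
Proof.
move=> [Ps PP]; rewrite -PP -{2}Ps => tr0.
apply/matrixP => a b; rewrite PP mxE.
have ge0 c d : 0 <= P c d * (P c d)^* by exact: mul_conjC_ge0.
have rowE c : (P *m P ^t*) c c = \sum_d P c d * (P c d)^*.
  by rewrite mxE; apply: eq_bigr => d _; rewrite !mxE.
move: tr0; rewrite /mxtrace; under eq_bigr do rewrite rowE.
move=> /psumr_eq0P h.
have /psumr_eq0P k := h (fun c _ => sumr_ge0 _ (fun d _ => ge0 c d)) a isT.
by apply/eqP; rewrite -mul_conjC_eq0 (k (fun d _ => ge0 a d)).
Qed.

(** A nonzero diagonal entry [P k k] is the squared norm of the [k]-th column,
    which [P] fixes.  Normalized to [psi], it gives a projector
    [P - |psi><psi|] of trace 0. *)
Lemma projector_rank1 (P : M) : projector P -> \tr P = 1 ->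
  exists psi : 'cV[R[i]]_n, unit_vector psi /\ P = ketbra psi.
Proof.
move=> [Ps PP] tr1.
have [k Pkk] : exists k, P k k != 0.
  apply/existsP; apply: contraT; rewrite negb_exists => /forallP P0.
  have := oner_neq0 R[i]; rewrite -tr1 /mxtrace big1 ?eqxx// => k _.
  by apply/eqP; rewrite -[_ == _]negbK; apply: P0.
have conjP a b : (P a b)^* = P b a by rewrite -[in RHS]Ps !mxE.
pose v := col k P; pose t := P k k.
have Pv : P *m v = v by rewrite /v colE mulmxA PP.
have vv : v ^t* *m v = t%:M.
  rewrite [LHS]mx11_scalar; congr _%:M.
  rewrite /t -[in RHS]PP mxE [RHS]mxE; apply: eq_bigr => a _.
  by rewrite !mxE conjP.
have t_gt0 : 0 < t.
  rewrite lt_def Pkk /t -PP -{2}Ps mxE sumr_ge0// => a _.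
  by rewrite !mxE mul_conjC_ge0.
pose psi := (sqrtC t)^-1 *: v.
have cE : ((sqrtC t)^-1)^* = (sqrtC t)^-1.
  by apply: conj_Creal; rewrite realE invr_ge0 sqrtC_ge0 ltW.
have psis : psi ^t* = (sqrtC t)^-1 *: v ^t*.
  by apply/matrixP => a b; rewrite !mxE rmorphM /= cE.
have cc : (sqrtC t)^-1 * (sqrtC t)^-1 = t^-1 by rewrite -invfM -expr2 sqrtCK.
have psi1 : unit_vector psi.
  rewrite /unit_vector psis -scalemxAl -scalemxAr scalerA cc vv scale_scalar_mx.
  by rewrite mulVf.
exists psi; split=> //; apply/eqP; rewrite -subr_eq0; apply/eqP.
have Ppsi : P *m psi = psi by rewrite -scalemxAr Pv.
have psiP : psi ^t* *m P = psi ^t* by rewrite -{1}Ps -map_mxM -trmx_mul Ppsi.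
apply: projector_tr0; last first.
  by rewrite raddfB /= tr1 /ketbra mxtrace_mulC psi1 mxtrace1 subrr.
split; first by rewrite raddfB /= map_mxB Ps ketbra_adj.
rewrite mulmxBl !mulmxBr PP.
have -> : P *m ketbra psi = ketbra psi by rewrite /ketbra mulmxA Ppsi.
have -> : ketbra psi *m P = ketbra psi by rewrite /ketbra -mulmxA psiP.
have -> : ketbra psi *m ketbra psi = ketbra psi.
  by rewrite /ketbra -mulmxA (mulmxA (psi ^t* )) psi1 mul1mx.
by rewrite subrr subr0.
Qed.

End Traces.

(** * Born points *)

Section BornPoints.
Variables (R : realType) (n : nat).

Definition sysPt (mu : opart n) (C : projsys R mu) : lmap ptLoc (ProjLoc R mu) :=
  spacePt (C : Proj R mu).

Definition fibrePt (mu : opart n) (C : projsys R mu) (i : 'I_(size mu)) :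
    lmap ptLoc (btot (ProjBundle R mu)) :=
  lpair (sysPt C) (discMap (fun=> i)).

Section Refined.
Variables (mu mu' : opart n) (r : refinement mu mu') (C' : projsys R mu').

Lemma sysPt_projMap : sysPt (projMap r C') = lcomp (ProjArr R r) (sysPt C').
Proof. exact: lmap_ext. Qed.

Lemma spec_inB :
  spec (lcomp (inB R mu) (sysPt (projMap r C')))
       (lcomp (inB R mu') (sysPt C')).
Proof.
move=> V; rewrite sysPt_projMap.
exact: (inv_mono (sysPt C') (laxIn_spec (act := @ProjArr R n) r V)).
Qed.

Lemma fibrePt_projMap i :
  fibrePt (projMap r C') (r i) = lcomp (ProjTotArr R r) (fibrePt C' i).
Proof.
rewrite [RHS]lpair_lprodMap /fibrePt sysPt_projMap; congr lpair.
exact: lmap_ext.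
Qed.

Lemma spec_inSigma i :
  spec (lcomp (inSigma R mu) (fibrePt (projMap r C') (r i)))
       (lcomp (inSigma R mu') (fibrePt C' i)).
Proof.
move=> V; rewrite fibrePt_projMap.
exact: (inv_mono (fibrePt C' i) (laxIn_spec (act := @ProjTotArr R n) r V)).
Qed.

End Refined.

Arguments spec_inB {mu mu'} r C'.
Arguments spec_inSigma {mu mu'} r C' i.

Section Pair.
Variables (mu nu : opart n) (C : projsys R mu) (D : projsys R nu).

(** The point ((C, i), (D, j)) of the product bundle space, for [x = (i, j)]. *)
Definition pairPt (x : 'I_(size mu) * 'I_(size nu)) :
    lmap ptLoc (btot (Sigma2 R n)) :=
  lpair (lcomp (inSigma R mu) (fibrePt C x.1))
        (lcomp (inSigma R nu) (fibrePt D x.2)).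

Let CD := lpair (sysPt C) (sysPt D).

Lemma pairTot_slice x :
  lcomp (pairTot R mu nu) (lcomp (slice _ x) CD) = pairPt x.
Proof.
rewrite slice_pt lpair_lcomp; congr lpair.
  suff e : lcomp (pairFst R mu nu) (lpair CD (discMap (fun=> x))) = fibrePt C x.1.
    by rewrite -e; apply: lmap_ext.
  rewrite lpair_lprodMap; congr lpair; apply: lmap_ext => V //.
  exact: lpair_fst.
suff e : lcomp (pairSnd R mu nu) (lpair CD (discMap (fun=> x))) = fibrePt D x.2.
  by rewrite -e; apply: lmap_ext.
rewrite lpair_lprodMap; congr lpair; apply: lmap_ext => V //.
exact: lpair_snd.
Qed.

Lemma Born_base a :
  Born C D (valProj (Sigma2 R n) a) =
  lpair (lcomp (inB R mu) (sysPt C)) (lcomp (inB R nu) (sysPt D)) a.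
Proof.
transitivity (lpair CD (valPoint (beta C D))
    (trivVal _ _ (valProj _ (pairBase R mu nu a)))).
  by congr (lpair _ _ (trivVal _ _ _)); apply: valMap_base.
by rewrite trivVal_base lpair_fst -lpair_lprodMap.
Qed.

Lemma Born_vgt U q :
  Born C D (vgt (p := Sigma2 R n) U q) tt <->
  exists2 F, (forall x, List.In x F -> pairPt x U tt) &
    ((ratr q : R)%:E < beta C D (lset F))%E.
Proof.
have -> : Born C D (vgt (p := Sigma2 R n) U q) = lpair CD (valPoint (beta C D))
    (trivVal _ _ (vgt (p := PairBundle R mu nu) (pairTot R mu nu U) q)).
  by congr (lpair _ _ (trivVal _ _ _)); apply: valMap_vgt.
rewrite trivVal_vgt inv_sup; split.
  move=> [_ [_ [F _ <-] <-]].
  rewrite inv_meet lpair_fst lpair_snd valPoint_vgt => -[h1 h2].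
  exists F => // x xF; rewrite -pairTot_slice.
  have := slices_mem (pairTot R mu nu U) xF.
  by move=> /(inv_mono CD); apply.
move=> [F hF hq]; eexists; first by eexists; [exists F; reflexivity|reflexivity].
rewrite inv_meet lpair_fst lpair_snd valPoint_vgt; split => //.
have : ole otop (CD (slices F (pairTot R mu nu U))).
  rewrite inv_gmeet; apply/conj_le => x xF [] _.
  by have := hF x xF; rewrite -pairTot_slice.
exact.
Qed.

End Pair.

Lemma spec_Born (mu nu mu' nu' : opart n) (C' : projsys R mu')
    (D' : projsys R nu') (r : refinement mu mu') (s : refinement nu nu') :
  spec (Born (projMap r C') (projMap s D')) (Born C' D').
Proof.
apply: spec_presLoc => -[a|[U q]] [].
  rewrite -/(valProj (Sigma2 R n) a) !Born_base.
  exact: (spec_lpair (spec_inB r C') (spec_inB s D') a tt).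
move=> /Born_vgt[F hF qF]; apply/Born_vgt.
(* The preimage of F under r x s, as a list. *)
exists [seq x <- enum {: 'I_(size mu') * 'I_(size nu')}
          | `[< List.In (r x.1, s x.2) F >]].
  move=> x /List.filter_In[_ /asboolP/hF].
  exact: (spec_lpair (spec_inSigma r C' x.1) (spec_inSigma s D' x.2) U tt).
rewrite beta_refine in qF; move: qF; congr (_ < beta C' D' _)%E.
apply/seteqP; split=> x.
  move=> h; apply/List.filter_In; split; last exact/asboolP.
  by apply: mem_In; rewrite mem_enum.
by move=> /List.filter_In[_ /asboolP].
Qed.

End BornPoints.

Unset Implicit Arguments.

Theorem mainTheorem1 (R : realType) (n : nat) (n_ge1 : (1 <= n)%N)
    (mu nu mu' nu' : opart n)
    (C : projsys R mu) (D : projsys R nu)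
    (C' : projsys R mu') (D' : projsys R nu')
    (r : refinement mu mu') (s : refinement nu nu')
    (hC : C = projMap r C') (hD : D = projMap s D') :
  (* (1) *)
  [/\ forall i j, 0 <= \tr (C i *m D j),
      forall i j, \tr (C i *m D j) =
        \sum_(x : 'I_(size mu') * 'I_(size nu') | (r x.1 == i) && (s x.2 == j))
          \tr (C' x.1 *m D' x.2) &
      beta C D = pushVal (discMap (fun x => (r x.1, s x.2))) (beta C' D')] /\
  (* (2) *)
  spec (Born C D) (Born C' D') /\
  (* (3) *)
  (forall i (K : nat) (psi : 'I_K -> 'cV[R[i]]_n), orthonormal_kets psi ->
     C i = \sum_k ketbra (psi k) ->
     forall j, \tr (C i *m D j) = \sum_k born_prob (psi k) (D j)) /\
  (forall i, \tr (C i) = 1 ->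
     (exists psi : 'cV[R[i]]_n, unit_vector psi /\ C i = ketbra psi) /\
     (forall psi : 'cV[R[i]]_n, unit_vector psi -> C i = ketbra psi ->
        forall j, \tr (C i *m D j) = born_prob psi (D j))).
Proof.
subst C D; split; last split; last split.
- split; [exact: trace_ge0|exact: trace_refine|exact: beta_refine].
- exact: spec_Born.
- move=> i K psi _ -> j; rewrite mulmx_suml raddf_sum.
  by apply: eq_bigr => k _; apply: trace_ketbra.
- move=> i tr1; split; first exact: projector_rank1 (ps_proj (psP _) i) tr1.
  by move=> psi _ -> j; apply: trace_ketbra.
Qed.
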